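(* (In ZFC) There exists a linearly ordered, compact, $0$-dimensional countable dense homogeneous space of weight $\omega_1$.
   Context: A separable topological space $X$ is countable dense homogeneous (CDH) if for any two countable dense subsets $D,E$ of $X$ there is a homeomorphism $f\colon X\to X$ with $f[D]=E$. ''Linearly ordered'' means that the topology is the order topology of a linear order. A space is $0$-dimensional if it has a base of clopen sets. The weight of a space is the least cardinality of a base for its topology. *)

(* Defs.v *)
From mathcomp Require Import all_boot all_order.
From mathcomp Require Import all_classical topology.
From mathcomp Require Import wochoice.
Set Implicit Arguments.
Unset Strict Implicit.
Unset Printing Implicit Defensive.

Local Open Scope classical_set_scope.
Local Open Scope card_scope.

Definition separable (X : topologicalType) : Prop :=
  exists2 D : set X, countable D & dense D.

Definition homeomorphism (X Y : topologicalType) (f : X -> Y) : Prop :=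
  exists g : Y -> X,
    [/\ cancel f g, cancel g f, continuous f & continuous g].

Definition countable_dense_homogeneous (X : topologicalType) : Prop :=
  separable X /\
  forall D E : set X, countable D -> dense D -> countable E -> dense E ->
    exists f : X -> X, homeomorphism f /\ f @` D = E.

(* The library's [zero_dimensional] only asks that clopen sets separate
   points, which is a different property outside the compact case. *)
Definition has_clopen_base (X : topologicalType) : Prop :=
  exists2 B : set (set X), basis B & B `<=` clopen.

(* [R] is the reflexive order; its order type is the first uncountable
   ordinal, so [[set: W]] has cardinality [omega_1]. *)
Definition omega1_well_order (W : eqType) (R : rel W) : Prop :=
  [/\ well_order R, ~ countable [set: W] &
      forall x : W, countable [set y | R y x]].

(* Cardinals are represented by sets, up to equipotence. *)
Definition has_weight (X : topologicalType) (W : Type) (K : set W) : Prop :=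
  (exists2 B : set (set X), basis B & B #= K) /\
  (forall B : set (set X), basis B -> K #<= B).

Definition has_weight_omega1 (X : topologicalType) : Prop :=
  exists (W : eqType) (R : rel W),
    omega1_well_order R /\ has_weight X [set: W].

(* Main.v *)
(* Let [c] be an omega_1-sequence in 2^nat which is a lambda'-set: every countable
   D can be separated by an F_sigma set from the members of the sequence not in D.
   Such a sequence comes from a Hausdorff gap (A_x, B_x): the F_sigma sets of all
   subsets of nat separating A_x from B_x modulo finite sets decrease with x and
   have empty intersection.
   Let A be the closure of the sequence under the exchange of finite prefixes, and
   let X be the lexicographically ordered Cantor set 2^nat in which each point of
   A is split into two.  X is compact, and it has weight omega_1 because only the
   clopen cuts at the points of A have to be added to the countably many cones.

   Each cone is an order copy of X, so X embeds as a clopen set in each of its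
   nonempty open sets.  Hence, by an infinite exchange of clopen pieces, any point
   of a clopen set U can be moved to any other by a homeomorphism supported on U
   which is locally order preserving away from one point.  Given countable dense D
   and E, a back-and-forth produces homeomorphisms h_n, each modifying the previous
   one on a small convex clopen set.  Countably many cuts separate all points which
   matter except for points of A covered by closed sets F_n disjoint from D and E;
   as the n-th modification takes place off F_0, ..., F_n, the limit of the h_n
   is a homeomorphism of X mapping D onto E. *)

From HB Require Import structures.
Require Import Defs.
From mathcomp Require Import all_boot all_order.
From mathcomp Require Import interval all_classical topology wochoice.
Set Implicit Arguments.
Unset Strict Implicit.
Unset Printing Implicit Defensive.
Import Order.TTheory.

Local Open Scope classical_set_scope.

(** * Countable sets and clopen sets *)

Lemma countable_image (T U : Type) (f : T -> U) (A : set T) :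
  countable A -> countable (f @` A).
Proof. exact/sub_countable/card_image_le. Qed.

Lemma countable_setU (T : Type) (A B : set T) :
  countable A -> countable B -> countable (A `|` B).
Proof.
move=> cA cB; rewrite (_ : A `|` B = \bigcup_(b in [set: bool]) if b then A else B).
  by apply: bigcup_countable => // -[].
apply/seteqP; split=> [x [?|?]|x [[] _ ?]].
- by exists true.
- by exists false.
- by left.
- by right.
Qed.
Lemma clopenC (X : topologicalType) (U : set X) : clopen U -> clopen (~` U).
Proof. by move=> [oU cU]; split; [rewrite openC|rewrite closedC]. Qed.

Lemma clopenI (X : topologicalType) (U V : set X) :
  clopen U -> clopen V -> clopen (U `&` V).
Proof. by move=> [oU cU] [oV cV]; split; [exact: openI|exact: closedI]. Qed.

Lemma clopenD (X : topologicalType) (U V : set X) :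
  clopen U -> clopen V -> clopen (U `\` V).
Proof. by move=> cU /clopenC; rewrite setDE; exact: clopenI. Qed.

(** * Limits of homeomorphisms *)

Definition decided {T : Type} (V Q : set T) := V `<=` Q \/ V `<=` ~` Q.

Lemma decidedC {T : Type} (V Q : set T) : decided V Q -> decided V (~` Q).
Proof. by case=> h; [right; rewrite setCK|left]. Qed.

Section compact_hausdorff.
Context {X : topologicalType}.
Hypotheses (cX : compact [set: X]) (hX : hausdorff_space X).
Implicit Types (f g : X -> X) (Q : set X).

Lemma closed_image f Q : continuous f -> closed Q -> closed (f @` Q).
Proof.
move=> cf cQ; apply: compact_closed => //; apply: continuous_compact.
  exact: continuous_subspaceT.
by apply: (subclosed_compact cQ cX).
Qed.

Lemma continuous_inverse f g :
  continuous f -> cancel f g -> cancel g f -> continuous g.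
Proof.
move=> cf fK gK; apply/continuous_closedP => A cA.
suff -> : g @^-1` A = f @` A by exact: closed_image.
apply/seteqP; split=> [y Ay|_ [x Ax <-]]; last by rewrite /preimage /= fK.
by exists (g y).
Qed.

(** The image is the open range minus the closed image of the complement of [Q]; surjectivity is not
    assumed, so that embeddings are covered. *)
Lemma clopen_image f Q :
  continuous f -> injective f -> open (range f) -> clopen Q ->
  clopen (f @` Q).
Proof.
move=> cf fI rf [oQ cQ]; split; last exact: closed_image.
suff -> : f @` Q = range f `&` ~` (f @` (~` Q)).
  by apply: openI => //; rewrite openC; apply: closed_image => //; rewrite closedC.
apply/seteqP; split=> [_ [x Qx <-]|_ [[x _ <-] h]].
  by split; [exists x|case=> z nQz /fI zx; apply: nQz; rewrite zx].
by exists x => //; apply: contrapT => nQ; apply: h; exists x.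
Qed.

(* The sequence [h n x] need not become constant, but each clopen set [Q] that
   the sets [V n] eventually do not split stops it from crossing the boundary
   of [Q]; a cluster point is therefore a limit. *)
Lemma limit_map (h : nat -> X -> X) (V : nat -> set X) :
  (forall n, continuous (h n)) ->
  (forall n x, h n.+1 x <> h n x -> V n (h n x) /\ V n (h n.+1 x)) ->
  (forall x O, open O -> O x -> exists Q n, [/\ clopen Q, Q x, Q `<=` O &
     forall m, (n <= m)%N -> decided (V m) Q]) ->
  exists h' : X -> X, [/\ continuous h',
    forall x P n, open P -> P (h' x) -> exists2 m, (n <= m)%N & P (h m x) &
    forall Q n, clopen Q -> (forall m, (n <= m)%N -> decided (V m) Q) ->
      forall x m, (n <= m)%N -> Q (h' x) <-> Q (h m x)].
Proof.
move=> ch hV sV.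
have stab Q n : (forall m, (n <= m)%N -> decided (V m) Q) ->
    forall x m, (n <= m)%N -> Q (h n x) <-> Q (h m x).
  move=> dQ x m /subnKC <-; elim: (m - n)%N => [|k IH]; first by rewrite addn0.
  rewrite addnS; apply: (iff_trans IH).
  have [->//|/eqP ne] := eqVneq (h (n + k).+1 x) (h (n + k)%N x).
  have [V1 V2] := hV _ _ ne.
  case: (dQ (n + k)%N (leq_addr _ _)) => VQ; split => // HQ.
  - exact: VQ.
  - exact: VQ.
  - by case: (VQ _ V1).
  - by case: (VQ _ V2).
(* By compactness the sequence of values at [x] has a cluster point. *)
have lim x : exists y, forall P n, open P -> P y ->
    exists2 m, (n <= m)%N & P (h m x).
  have [|y [_ cy]] := cX (fmap_proper_filter (h^~ x) eventually_filter).
    by exists 0.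
  exists y => P n oP Py.
  have [||z [[m /= nm <-] Pz]] := cy (h^~ x @` [set m | (n <= m)%N]) P.
  - by exists n => // m /= nm; exists m.
  - exact: open_nbhs_nbhs.
  - by exists m.
have [h' h'P] := choice lim.
have stab' Q n : clopen Q -> (forall m, (n <= m)%N -> decided (V m) Q) ->
      forall x m, (n <= m)%N -> Q (h' x) <-> Q (h m x).
  move=> [oQ cQ] dQ x m nm; split=> [Qx|].
    have [k nk Qk] := h'P x Q n oQ Qx.
    by apply/(stab Q n dQ x m nm)/(stab Q n dQ x k nk).
  move=> Qm; apply: contrapT => nQ.
  have [|k nk nQk] := h'P x (~` Q) n _ nQ; first by rewrite openC.
  by apply: nQk; apply/(stab Q n dQ x k nk)/(stab Q n dQ x m nm).
exists h'; split => // x O /=; rewrite nbhsE /= => -[O' [oO' O'x] O'O].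
have [Q [n [cQ Qx QO' dQ]]] := sV _ _ oO' O'x.
apply: filterS (_ : nbhs x (h n @^-1` Q)).
  by move=> z Qz; apply/O'O/QO'/(stab' Q n cQ dQ z n).
apply: open_nbhs_nbhs; split; last by apply/(stab' Q n cQ dQ x n).
by move/continuousP: (ch n); apply; case: cQ.
Qed.

(** [limit_map] applies to [h] with the images of [U n] under [h n], and to the inverses [g] with
    the sets [U n]. If [g' (h' x)] differed from [x], some clopen [Q] around it would miss [x]; at a
    late stage [m], [Q] contains [g' (h m x)] and hence [g m (h m x)], which is [x]. *)
Lemma limit_homeomorphism (h g : nat -> X -> X) (U : nat -> set X) :
  (forall n, continuous (h n)) ->
  (forall n, cancel (h n) (g n)) -> (forall n, cancel (g n) (h n)) ->
  (forall n x, ~ U n x -> h n.+1 x = h n x) ->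
  (forall n x, U n x -> (h n @` U n) (h n.+1 x)) ->
  (forall x O, open O -> O x -> exists Q n, [/\ clopen Q, Q x, Q `<=` O &
     forall m, (n <= m)%N -> decided (U m) Q /\ decided (h m @` U m) Q]) ->
  exists2 h' : X -> X, homeomorphism h' &
    forall x n, (forall m, (n <= m)%N -> h m x = h n x) -> h' x = h n x.
Proof.
move=> ch hK gK hU hV sUV.
have cg n : continuous (g n) by apply: (continuous_inverse (ch n)).
have gV n y : ~ (h n @` U n) y -> g n.+1 y = g n y.
  move=> nV; have [Ux|nUx] := pselect (U n (g n.+1 y)).
    by case: nV; have := hV _ _ Ux; rewrite gK.
  by rewrite -[in RHS](gK n.+1 y) hU // hK.
have gU n y : (h n @` U n) y -> U n (g n.+1 y).
  move=> Vy; apply: contrapT => nU; have := hU _ _ nU.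
  by rewrite gK => yE; move: Vy; rewrite yE => -[z Uz /(can_inj (hK n)) zE]; rewrite -zE in nU.
have [|x O oO Ox|h' [ch' clh sth]] := @limit_map h (fun n => h n @` U n) ch.
- move=> n x ne; have [Ux|/hU//] := pselect (U n x).
  by split; [exists x|exact: hV].
- have [Q [n [? ? ? dQ]]] := sUV x O oO Ox; exists Q, n; split => // m /dQ.
  by case.
have [|x O oO Ox|g' [cg' clg stg]] := @limit_map g U cg.
- move=> n y ne; have [Vy|/gV//] := pselect ((h n @` U n) y).
  by split; [case: Vy => x Ux <-; rewrite hK|exact: gU].
- have [Q [n [? ? ? dQ]]] := sUV x O oO Ox; exists Q, n; split => // m /dQ.
  by case.
have h'K : cancel h' g'.
  move=> x; apply: contrapT => ne.
  have [|Q [n [cQ Qx QO dQ]]] := sUV (g' (h' x)) (~` [set x]) _ (fun e => ne e).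
    by rewrite openC; apply: (accessible_closed_set1 (hausdorff_accessible hX)).
  have dU m : (n <= m)%N -> decided (U m) Q by case/dQ.
  have oP : open (g n @^-1` Q).
    by move/continuousP: (cg n); apply; case: cQ.
  have [|m nm] := clh x _ n oP; first by apply/(stg Q n cQ dU).
  rewrite /preimage /= => Qm; apply: (QO x) => //.
  have /(stg Q n cQ dU (h m x) m nm) : Q (g' (h m x)).
    by apply/(stg Q n cQ dU (h m x) n).
  by rewrite hK.
have g'K : cancel g' h'.
  move=> y; apply: contrapT => ne.
  have [|Q [n [cQ Qx QO dQ]]] := sUV (h' (g' y)) (~` [set y]) _ (fun e => ne e).
    by rewrite openC; apply: (accessible_closed_set1 (hausdorff_accessible hX)).
  have dV m : (n <= m)%N -> decided (h m @` U m) Q by case/dQ.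
  have oP : open (h n @^-1` Q).
    by move/continuousP: (ch n); apply; case: cQ.
  have [|m nm] := clg y _ n oP; first by apply/(sth Q n cQ dV).
  rewrite /preimage /= => Qm; apply: (QO y) => //.
  have /(sth Q n cQ dV (g m y) m nm) : Q (h' (g m y)).
    by apply/(sth Q n cQ dV (g m y) n).
  by rewrite gK.
exists h'; first by exists g'.
move=> x n hx; apply: contrapT => ne.
have [|m nm] := clh x (~` [set h n x]) n _ ne.
  by rewrite openC; apply: (accessible_closed_set1 (hausdorff_accessible hX)).
by rewrite hx //; apply.
Qed.

End compact_hausdorff.

(** * Self-similar ordered spaces are countable dense homogeneous *)

Lemma glue (T K : Type) (A B : K -> set T) (f g : K -> T -> T) :
  (forall x, exists k, A k x) -> (forall k l x, A k x -> A l x -> k = l) ->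
  (forall y, exists k, B k y) -> (forall k l y, B k y -> B l y -> k = l) ->
  (forall k x, A k x -> B k (f k x)) -> (forall k y, B k y -> A k (g k y)) ->
  (forall k x, A k x -> g k (f k x) = x) ->
  (forall k y, B k y -> f k (g k y) = y) ->
  exists F G, [/\ cancel F G, cancel G F & forall k x, A k x -> F x = f k x].
Proof.
move=> covA disA covB disB fAB gBA gfK fgK.
have [a aA] := choice covA; have [b bB] := choice covB.
have FE k x : A k x -> f (a x) x = f k x by move=> /(disA _ _ _ (aA x)) ->.
have GE k x : B k x -> g (b x) x = g k x by move=> /(disB _ _ _ (bB x)) ->.
exists (fun x => f (a x) x), (fun y => g (b y) y); split => // [x|y].
  by rewrite (GE (a x)) ?gfK //; exact: fAB.
by rewrite (FE (b y)) ?fgK //; exact: gBA.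
Qed.

(** * Germs of local order isomorphisms *)

Section order_germs.
Context {d : Order.disp_t} {X : orderTopologicalType d}.
Implicit Types (f g : X -> X) (N U V O M : set X).

Definition order_convex N :=
  forall x y z : X, N x -> N z -> (x <= y)%O -> (y <= z)%O -> N y.

Lemma order_cvg f x :
  (forall p, (p < f x)%O -> \forall z \near x, (p < f z)%O) ->
  (forall q, (f x < q)%O -> \forall z \near x, (f z < q)%O) ->
  {for x, continuous f}.
Proof.
move=> fl fr O; rewrite {1}itv_nbhsE => -[i [io xi] iO]; rewrite nbhs_simpl.
suff : nbhs x (f @^-1` [set` i]) by apply: filterS => z; exact: iO.
case: i io xi {iO} => [[[] l|[]] [[] r|[]]] //= _; rewrite in_itv /= ?andbT.
- move=> /andP[lx xr]; apply: filterS2 (fl _ lx) (fr _ xr) => z lz zr.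
  by rewrite /= in_itv /= lz.
- by move=> lx; apply: filterS (fl _ lx) => z lz; rewrite /= in_itv /= lz.
- by move=> xr; apply: filterS (fr _ xr) => z zr; rewrite /= in_itv /= zr.
- by move=> _; apply: filterS filterT => z _; rewrite /= in_itv.
Qed.

(* The maps of the back-and-forth are not globally monotone; what survives
   composition is that, away from finitely many points, they are locally
   isomorphisms of convex sets. *)
Definition germ M f x := exists N, [/\ open N, N x, order_convex N,
  [/\ forall y z, N y -> N z -> (y < z)%O -> (f y < f z)%O &
      order_convex (f @` N)] & forall y, N y -> M y <-> M (f y)].

(** A value below [f x] that is attained on [N] is attained at some [w < x], and the ray above [w]
    is the required neighbourhood. If it is not attained, convexity of the image puts all of it
    above that value. The other side is symmetric. *)
Lemma germ_cvg M f x : germ M f x -> {for x, continuous f}.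
Proof.
move=> [N [oN Nx cN [fN cfN] _]].
have nN : nbhs x N by exact: open_nbhs_nbhs.
apply: order_cvg => p px.
- have [[w Nw wp]|np] := pselect ((f @` N) p).
    have wx : (w < x)%O.
      rewrite ltNge; apply/negP; rewrite le_eqVlt => /predU1P[xw|xw].
        by move: px; rewrite -wp xw ltxx.
      by have := lt_trans (fN _ _ Nx Nw xw) (_ : (f w < f x)%O); rewrite wp ltxx => /(_ px).
    have : nbhs x `]w, +oo[.
      by apply: open_nbhs_nbhs; split; [exact: rray_open|rewrite set_itvE].
    by rewrite set_itvE; apply: filterS2 nN => z Nz wz; rewrite -wp; apply: fN.
  apply: filterS nN => z Nz; rewrite ltNge; apply/negP => zp; apply: np.
  by apply: (cfN (f z) p (f x)); [exists z|exists x| |exact: ltW].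
- have [[w Nw wp]|np] := pselect ((f @` N) p).
    have wx : (x < w)%O.
      rewrite ltNge; apply/negP; rewrite le_eqVlt => /predU1P[xw|xw].
        by move: px; rewrite -wp xw ltxx.
      by have := lt_trans (fN _ _ Nw Nx xw) (_ : (f x < f w)%O); rewrite wp ltxx => /(_ px).
    have : nbhs x `]-oo, w[.
      by apply: open_nbhs_nbhs; split; [exact: lray_open|rewrite set_itvE].
    by rewrite set_itvE; apply: filterS2 nN => z Nz wz; rewrite -wp; apply: fN.
  apply: filterS nN => z Nz; rewrite ltNge; apply/negP => zp; apply: np.
  by apply: (cfN (f x) p (f z)); [exists x|exists z|exact: ltW|].
Qed.

Lemma convex_image f N U : (forall y z, N y -> N z -> (y < z)%O -> (f y < f z)%O) ->
  order_convex (f @` N) -> U `<=` N -> order_convex U -> order_convex (f @` U).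
Proof.
move=> fN cfN UN cU _ y _ [x Ux <-] [z Uz <-] xy yz.
have [|| w Nw wy] := cfN (f x) y (f z) _ _ xy yz.
- by exists x => //; apply: UN.
- by exists z => //; apply: UN.
exists w => //; apply: (cU x _ z) => //.
- rewrite leNgt; apply/negP => wx.
  by have := fN w x Nw (UN _ Ux) wx; rewrite wy ltNge xy.
- rewrite leNgt; apply/negP => wx.
  by have := fN z w (UN _ Uz) Nw wx; rewrite wy ltNge yz.
Qed.

Hypothesis convex_base : forall (x : X) O, open O -> O x ->
  exists U, [/\ clopen U, order_convex U, U x & U `<=` O].

Lemma germ_restrict M f x O : germ M f x -> open O -> O x ->
  exists N, [/\ clopen N, N `<=` O, N x, order_convex N &
    [/\ forall y z, N y -> N z -> (y < z)%O -> (f y < f z)%O,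
      forall U, U `<=` N -> order_convex U -> order_convex (f @` U)
      & forall y, N y -> M y <-> M (f y)]].
Proof.
move=> [N [oN Nx cN [fN cfN] fM]] oO Ox.
have [||U [cU coU Ux UNO]] := convex_base (O := N `&` O) (x := x) _ _.
- exact: openI.
- by [].
have UN : U `<=` N by move=> z /UNO[].
exists U; split => //; first by move=> z /UNO[].
split=> [y z /UN Ny /UN Nz|V VU cV|y /UN]; [exact: fN| |exact: fM].
by apply: convex_image fN cfN _ cV => z /VU/UN.
Qed.

Lemma germ_congr M f g x O : germ M f x -> open O -> O x ->
  (forall y, O y -> g y = f y) -> germ M g x.
Proof.
move=> gf oO Ox fg; have [N [[oN _] NO Nx cN [fN cf fM]]] := germ_restrict gf oO Ox.
exists N; split => //; last by move=> y Ny; rewrite fg; [exact: fM|exact: NO].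
have -> : g @` N = f @` N by apply: eq_imagel => y /NO/fg.
split; last exact: cf.
by move=> y z Ny Nz yz; rewrite !fg; [apply: fN|apply: NO..].
Qed.

Lemma germ_comp M f g x : germ M f x -> germ M g (f x) -> germ M (g \o f) x.
Proof.
move=> gf [N' [oN' N'x cN' [gN' cgN'] gM]].
have : nbhs x (f @^-1` N') by apply: (germ_cvg gf); exact: open_nbhs_nbhs.
rewrite nbhsE => -[O [oO Ox] ON'].
have [N [[oN _] NO Nx cN [fN cf fM]]] := germ_restrict gf oO Ox.
exists N; split => //.
- split=> [y z Ny Nz yz|].
    by apply: gN'; [apply/ON'/NO|apply/ON'/NO|apply: fN].
  rewrite -image_comp; apply: convex_image gN' cgN' _ _; last exact: cf.
  by move=> _ [y /NO/ON' ? <-].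
- by move=> y Ny; rewrite (fM y Ny) /=; apply: gM; apply/ON'/NO.
Qed.

Lemma germ_id M x : germ M id x.
Proof.
exists setT; split => //; [exact: openT|split => // y z t _ _ _ _; by exists z].
Qed.

End order_germs.

(** * Compact ordered spaces with a clopen copy of themselves in every nonempty open set *)

Section self_similar.
Context {d : Order.disp_t} {X : orderTopologicalType d}.
Context {I : countType} (eps : I -> X -> X).
Hypothesis cX : compact [set: X].
Hypothesis epsI : forall s x y, (x < y)%O -> (eps s x < eps s y)%O.
Hypothesis eps_convex : forall s, order_convex (range (eps s)).
Hypothesis eps_open : forall s, open (range (eps s)).
Hypothesis eps_dense : forall (O : set X), open O -> O !=set0 ->
  exists s, range (eps s) `<=` O.
Hypothesis X2 : exists a b : X, (a < b)%O.
Hypothesis convex_basis : forall x : X, exists B : nat -> set X,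
  (forall n, [/\ clopen (B n), order_convex (B n) & B n x]) /\
  (forall O, open O -> O x -> exists n, B n `<=` O).

Let hX : hausdorff_space X := @order_hausdorff d X.

Lemma convex_nbhs (x : X) O : open O -> O x ->
  exists U, [/\ clopen U, order_convex U, U x & U `<=` O].
Proof.
move=> oO Ox; have [B [BP]] := convex_basis x => /(_ O oO Ox)[n BO].
by exists (B n); have [] := BP n.
Qed.

Let eps_inj s : injective (eps s).
Proof.
move=> x y; have [xy|yx|//] := ltgtP x y.
- by move=> e; have := epsI s xy; rewrite e ltxx.
- by move=> e; have := epsI s yx; rewrite e ltxx.
Qed.

(** The inverse of [eps s] on its range; a point off the range is returned unchanged. *)
Let einv s y := xget y (eps s @^-1` [set y]).

Let epsK s x : einv s (eps s x) = x.
Proof. by apply: (@eps_inj s); rewrite /einv; case: xgetP => [z _ ->|/(_ x) /=] //; case. Qed.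

Let einvK s y : range (eps s) y -> eps s (einv s y) = y.
Proof. by case=> x _ <-; rewrite epsK. Qed.

Let germ_eps M s x : (forall y, M y <-> M (eps s y)) -> germ M (eps s) x.
Proof.
move=> sM; exists setT; split => //; [exact: openT|split] => //.
by move=> y z _ _; exact: epsI.
Qed.

Let germ_einv M s x : (forall y, M y <-> M (eps s y)) -> range (eps s) x ->
  germ M (einv s) x.
Proof.
move=> sM rx; exists (range (eps s)); split => //.
- split=> [_ _ [y _ <-] [z _ <-]|y z t _ _ _ _]; last first.
    by exists (eps s z); rewrite ?epsK //; exists z.
  rewrite !epsK; have [//|zy|->] := ltgtP y z; last by rewrite ltxx.
  by move=> yz; have := lt_trans yz (epsI s zy); rewrite ltxx.
- by move=> _ [y _ <-]; rewrite epsK; apply: iff_sym.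
Qed.

Lemma eps_continuous s : continuous (eps s).
Proof. by move=> x; apply: (@germ_cvg _ _ set0); exact: germ_eps. Qed.

Let eps_clopen s U : clopen U -> clopen (eps s @` U).
Proof.
exact: (clopen_image cX hX (@eps_continuous s) (@eps_inj s) (eps_open s)).
Qed.

(** There are no isolated points, as every nonempty open set contains a copy of the space, which has
    two points. *)
Lemma other_point (x : X) O : open O -> O x -> exists2 z, O z & z <> x.
Proof.
move=> oO Ox; have [s sO] := eps_dense oO (ex_intro _ x Ox).
have [a [b /(epsI s) ab]] := X2.
have [ax|] := pselect (eps s a = x); last first.
  by exists (eps s a) => //; apply: sO; exists a.
exists (eps s b); first by apply: sO; exists b.
by move=> bx; move: ab; rewrite ax bx ltxx.
Qed.

(** [B n.+1] is the intersection of [B n] with the [n]-th member of a local base, which makes the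
    sequence a base at [x], and with a member missing another point of [B n], which makes all annuli
    nonempty. *)
Lemma shrinking_basis U (x : X) : clopen U -> U x -> exists B : nat -> set X,
  [/\ B 0%N = U, forall n, clopen (B n) /\ B n x,
     forall n, B n.+1 `<=` B n,
     forall n, exists2 z, B n z & ~ B n.+1 z &
     forall O, open O -> O x -> exists n, B n `<=` O].
Proof.
move=> cU Ux; have [K [KP KO]] := convex_basis x.
have step (p : nat * set X) : exists B, clopen p.2 -> p.2 x ->
    [/\ clopen B, B x, B `<=` p.2, B `<=` K p.1 & exists2 z, p.2 z & ~ B z].
  case: p => n A /=; have [[cA Ax]|nA] := pselect (clopen A /\ A x); last first.
    by exists set0 => ? ?; case: nA.
  have [z Az zx] := other_point (proj1 cA) Ax.
  have [||m Km] := KO (~` [set z]).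
  - by rewrite openC; apply: accessible_closed_set1; exact: hausdorff_accessible.
  - by move=> /= e; apply: zx.
  exists (A `&` (K n `&` K m)) => _ _.
  have [[oKn cKn] _ Knx] := KP n; have [[oKm cKm] _ Kmx] := KP m.
  split => //.
  - case: cA => oA cA.
    by split; [do 2 apply: openI => //|do 2 apply: closedI => //].
  - by move=> y [_ []].
  - by exists z => // -[_ [_ /Km]]; apply.
have [F FP] := choice step.
pose B := fix B n := if n is m.+1 then F (m, B m) else U.
have BP n : clopen (B n) /\ B n x.
  by elim: n => // n [cB Bx]; have [] := FP (n, B n) cB Bx.
have BS n := FP (n, B n) (proj1 (BP n)) (proj2 (BP n)).
exists B; split => // [n|n|O oO Ox].
- by have [] := BS n.
- by have [] := BS n.
- by have [n nO] := KO _ oO Ox; exists n.+1 => y; have [_ _ _ h _] := BS n => /h/nO.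
Qed.

Section annuli.
Variables (B : nat -> set X) (x : X).
Hypothesis BP : forall n, clopen (B n) /\ B n x.
Hypothesis BS : forall n, B n.+1 `<=` B n.
Hypothesis BO : forall O, open O -> O x -> exists n, B n `<=` O.

Definition annulus n := B n `\` B n.+1.

Let B_mono m n : (m <= n)%N -> B n `<=` B m.
Proof.
move=> /subnKC <-; elim: (n - m)%N => [|k IH]; first by rewrite addn0.
by rewrite addnS => y /BS/IH.
Qed.

Lemma annulus_cover y : B 0%N y -> y <> x -> exists n, annulus n y.
Proof.
move=> By yx; apply: contrapT => nr.
have [||n nO] := BO (O := ~` [set y]) _ _.
- by rewrite openC; apply: accessible_closed_set1; exact: hausdorff_accessible.
- by move=> /= e; apply: yx.
suff : B n y by move/nO; apply.
elim: n {nO} => // n IH; apply: contrapT => nB; apply: nr; by exists n.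
Qed.

Lemma annulus_inj m n y : annulus m y -> annulus n y -> m = n.
Proof.
move=> [Bm nBm] [Bn nBn]; have [mn|nm|//] := ltngtP m n.
- by case: nBm; apply: B_mono Bn.
- by case: nBn; apply: B_mono Bm.
Qed.

Lemma annulus_notin n : ~ annulus n x.
Proof. by case=> _; apply; have [] := BP n.+1. Qed.

Lemma annulus_sub m n : (m <= n)%N -> annulus n `<=` B m.
Proof. by move=> mn y [/(B_mono mn)]. Qed.

Lemma annulus_clopen n : clopen (annulus n).
Proof. by have [cB _] := BP n; have [cB' _] := BP n.+1; exact: clopenD. Qed.

Lemma annulus_index m y : B m y -> forall n, annulus n y -> (m <= n)%N.
Proof.
move=> Bm n [_ nB]; rewrite leqNgt; apply/negP => nm; apply: nB.
exact: (B_mono nm).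
Qed.

End annuli.
(* Write [U \ {a}] and [U \ {b}] as disjoint unions of clopen annuli [A n] and
   [B n] converging to [a] and to [b].  Alternately, what is left of [A n] is
   copied into [B n] by some [eps], and what is left of [B n] into [A n.+1]. *)
Lemma move_point M U (a b : X) : (forall s y, M y <-> M (eps s y)) ->
  clopen U -> U a -> U b -> exists F G : X -> X,
  [/\ cancel F G, cancel G F, continuous F, F a = b &
    [/\ forall x, ~ U x -> F x = x, forall x, U x -> U (F x) &
      forall x, x <> a -> germ M F x]].
Proof.
move=> sM cU Ua Ub.
have [A [A0 AP AS Ane AO]] := shrinking_basis cU Ua.
have [B [B0 BP BS Bne BO]] := shrinking_basis cU Ub.
have copy n : exists s, range (eps s) `<=` annulus B n.
  apply: eps_dense; first by have [] := annulus_clopen BP n.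
  by have [z Bz nBz] := Bne n; exists z.
have copy' n : exists s, range (eps s) `<=` annulus A n.+1.
  apply: eps_dense; first by have [] := annulus_clopen AP n.+1.
  by have [z Az nAz] := Ane n.+1; exists z.
have [s sP] := choice copy; have [t tP] := choice copy'.
pose P := fix P n : set X := if n is m.+1
  then annulus A m.+1 `\` (eps (t m) @` (annulus B m `\` (eps (s m) @` P m)))
  else annulus A 0.
pose Q n := annulus B n `\` (eps (s n) @` P n).
have PA n : P n `<=` annulus A n by case: n => // n x [].
have QB n : Q n `<=` annulus B n by move=> x [].
have PB n : eps (s n) @` P n `<=` annulus B n.
  by move=> _ [x _ <-]; apply: sP; exists x.
have QA n : eps (t n) @` Q n `<=` annulus A n.+1.
  by move=> _ [x _ <-]; apply: tP; exists x.
have cP n : clopen (P n).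
  elim: n => [|n IH]; first exact: annulus_clopen.
  apply: clopenD; first exact: annulus_clopen.
  by apply/eps_clopen/clopenD; [exact: annulus_clopen|exact: eps_clopen].
have cQ n : clopen (Q n).
  by apply: clopenD; [exact: annulus_clopen|exact: eps_clopen].
(* Indices of the pieces of both partitions: [None] for the complement of [U], [Some None] for the
   exceptional point, [inl n] for [P n] and its copy, [inr n] for [Q n] and its copy. *)
pose K := option (option (nat + nat)).
pose D (k : K) := match k with
  | None => ~` U | Some None => [set a]
  | Some (Some (inl n)) => P n | Some (Some (inr n)) => eps (t n) @` Q n end.
pose E (k : K) := match k with
  | None => ~` U | Some None => [set b]
  | Some (Some (inl n)) => eps (s n) @` P n | Some (Some (inr n)) => Q n end.
pose f (k : K) := match k with
  | None => id | Some None => fun=> b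
  | Some (Some (inl n)) => eps (s n) | Some (Some (inr n)) => einv (t n) end.
pose g (k : K) := match k with
  | None => id | Some None => fun=> a
  | Some (Some (inl n)) => einv (s n) | Some (Some (inr n)) => eps (t n) end.
have AU n : A n `<=` U by elim: n => [|n IH]; [rewrite A0|move=> y /AS/IH].
have rAU n : annulus A n `<=` U by rewrite -A0; apply: annulus_sub.
have rBU n : annulus B n `<=` U by rewrite -B0; apply: annulus_sub.
have naA n : ~ annulus A n a by exact: annulus_notin.
have nbB n : ~ annulus B n b by exact: annulus_notin.
have covD x : exists k, D k x.
  have [Ux|] := pselect (U x); last by exists None.
  have [->|xa] := pselect (x = a); first by exists (Some None).
  have [|n rx] := annulus_cover AO _ xa; first by rewrite A0.
  have [Px|nP] := pselect (P n x); first by exists (Some (Some (inl n))).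
  case: n rx nP => [|n] rx nP; first by case: nP.
  exists (Some (Some (inr n))) => /=; apply: contrapT => nQ.
  by apply: nP; split.
have covE y : exists k, E k y.
  have [Uy|] := pselect (U y); last by exists None.
  have [->|yb] := pselect (y = b); first by exists (Some None).
  have [|n ry] := annulus_cover BO _ yb; first by rewrite B0.
  have [Py|nP] := pselect ((eps (s n) @` P n) y); first by exists (Some (Some (inl n))).
  by exists (Some (Some (inr n))).
have disPQ m n x : P m x -> (eps (t n) @` Q n) x -> False.
  move=> Px Qx; have := annulus_inj AS (PA _ _ Px) (QA _ _ Qx).
  by move=> mn; move: Px; rewrite mn => -[_]; apply.
have disQP m n x : Q m x -> (eps (s n) @` P n) x -> False.
  move=> Qx Px; have := annulus_inj BS (QB _ _ Qx) (PB _ _ Px).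
  by move=> mn; move: Qx; rewrite mn => -[_]; apply.
have disD k l x : D k x -> D l x -> k = l.
  case: k l => [[[m|m]|]|] [[[n|n]|]|] //=.
  - by move=> /PA h /PA/(annulus_inj AS h) ->.
  - by move=> Px Qx; case: (disPQ _ _ _ Px Qx).
  - by move=> /PA + xa; rewrite xa => /naA.
  - by move=> /PA/rAU.
  - by move=> Qx Px; case: (disPQ _ _ _ Px Qx).
  - by move=> /QA h /QA/(annulus_inj AS h) [->].
  - by move=> /QA + xa; rewrite xa => /naA.
  - by move=> /QA/rAU.
  - by move=> -> /PA/naA.
  - by move=> -> /QA/naA.
  - by move=> ->.
  - by move=> nU /PA/rAU.
  - by move=> nU /QA/rAU.
  - by move=> + xa; rewrite xa.
have disE k l x : E k x -> E l x -> k = l.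
  case: k l => [[[m|m]|]|] [[[n|n]|]|] //=.
  - by move=> /PB h /PB/(annulus_inj BS h) ->.
  - by move=> Px Qx; case: (disQP _ _ _ Qx Px).
  - by move=> /PB + xa; rewrite xa => /nbB.
  - by move=> /PB/rBU.
  - by move=> Qx Px; case: (disQP _ _ _ Qx Px).
  - by move=> /QB h /QB/(annulus_inj BS h) ->.
  - by move=> /QB + xa; rewrite xa => /nbB.
  - by move=> /QB/rBU.
  - by move=> -> /PB/nbB.
  - by move=> -> /QB/nbB.
  - by move=> ->.
  - by move=> nU /PB/rBU.
  - by move=> nU /QB/rBU.
  - by move=> + xa; rewrite xa.
have fDE k x : D k x -> E k (f k x).
  case: k => [[[n|n]|]|] //=; first by exists x.
  by move=> [y Qy <-]; rewrite epsK.
have gED k x : E k x -> D k (g k x).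
  case: k => [[[n|n]|]|] //=; first by move=> [y Py <-]; rewrite epsK.
  by exists x.
have gfK k x : D k x -> g k (f k x) = x.
  case: k => [[[n|n]|]|] //= Dx.
  by rewrite einvK //; case: Dx => y _ <-; exists y.
have fgK k x : E k x -> f k (g k x) = x.
  case: k => [[[n|n]|]|] //= Dx.
  by rewrite einvK //; case: Dx => y _ <-; exists y.
have [F [G [FK GK FE]]] := glue covD disD covE disE fDE gED gfK fgK.
have Fa : F a = b by rewrite (FE (Some None)).
have Fg x : x <> a -> germ M F x.
  have [k Dx] := covD x; move=> xa.
  apply: (@germ_congr _ _ convex_nbhs _ (f k) _ _ (D k)) => //.
  - case: k Dx => [[[n|n]|]|] //= Dx.
    + exact: germ_eps.
    + by apply: germ_einv => //; case: Dx => y _ <-; exists y.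
    + exact: germ_id.
  - case: k Dx => [[[n|n]|]|] //= Dx.
    + by case: (cP n).
    + by case: (eps_clopen (t n) (cQ n)).
    + by rewrite openC; case: cU.
  - by move=> y /FE.
exists F, G; split => //.
- move=> x; have [->|xa] := pselect (x = a); last exact: germ_cvg (Fg x xa).
  move=> O; rewrite Fa nbhsE => -[O' [oO O'b] O'O].
  (* [F] maps [A n.+1] into [B n]: the index may drop by one because the copy of [Q m] lies in
     annulus [m.+1] of [A]. *)
  have [n BnO] := BO _ oO O'b; apply: filterS (_ : nbhs a (A n.+1)); last first.
    by apply: open_nbhs_nbhs; case: (AP n.+1) => -[].
  move=> y Ay; apply/O'O/BnO; have [k Dy] := covD y; rewrite /= (FE k y Dy).
  case: k Dy => [[[m|m]|]|] /= Dy.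
  + apply: (@annulus_sub B _ n m); last by apply: PB; exists y.
      by [].
    by apply/ltnW/(annulus_index AS Ay)/PA.
  + apply: (@annulus_sub B _ n m); [by []|by rewrite -ltnS; apply: (annulus_index AS Ay); exact: QA|].
    by apply: QB; case: Dy => z Qz <-; rewrite epsK.
  + by have [] := BP n.
  + by case: Dy; apply: AU Ay.
- split => // [x nU|x Ux]; first by rewrite (FE None).
  apply: contrapT => nU; have := FE None _ nU.
  by rewrite /= => e; apply: nU; rewrite (can_inj FK e).
Qed.

(** * The back-and-forth construction *)

Lemma countable_saturation S : countable S -> exists M : set X,
  [/\ countable M, S `<=` M & forall s y, M y <-> M (eps s y)].
Proof.
(* Closing under [eps s] gives one implication of the invariance, closing under [einv s] the
   other. *)
move=> cS; pose M := fix M n : set X := if n is m.+1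
  then \bigcup_(s in [set: I]) (eps s @` M m `|` einv s @` M m) else S.
exists (\bigcup_n M n); split.
- apply: bigcup_countable => // n _; elim: n => //= n IH.
  apply: bigcup_countable => // s _.
  by apply: countable_setU; exact: countable_image.
- by move=> x Sx; exists 0.
- move=> s y; split=> -[n _ My]; exists n.+1 => //; exists s => //.
  + by left; exists y.
  + by right; exists (eps s y).
Qed.

(* [Adm n] consists of the sets small enough to be modified at step [n]. *)
Section back_and_forth.
Variables (D E M : set X) (Adm : nat -> set (set X)).
Hypotheses (DM : D `<=` M) (EM : E `<=` M) (dD : dense D) (dE : dense E).
Hypothesis Meps : forall s y, M y <-> M (eps s y).
Hypothesis Adm_local : forall n x, M x -> exists N,
  [/\ open N, N x & forall U, U `<=` N -> order_convex U -> Adm n U].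

Let state := ((X -> X) * (X -> X) * set X)%type.

(** [T] collects the points of [D] whose images are settled. Only off [T] is [h] known to carry
    small convex sets to convex sets, so only there can it be modified. *)
Definition partial_sol (st : state) := let: (h, g, T) := st in
  [/\ cancel h g, cancel g h, continuous h,
    forall x, ~ T x -> germ M h x &
    closed T /\ forall t, T t -> D t /\ E (h t)].

Definition extends n (st st' : state) :=
  let: (h, g, T) := st in let: (h', g', T') := st' in
  exists U, [/\ Adm n U, Adm n (h @` U), forall t, T t -> ~ U t,
    forall x, ~ U x -> h' x = h x &
    (forall x, U x -> (h @` U) (h' x)) /\ T `<=` T'].

(** The germ of [h] at [c] respects [M], so [h c] is in [M] as well, and smallness can be achieved
    at [c] and at [h c] simultaneously. *)
Lemma admissible_nbhs n h g T c : partial_sol (h, g, T) -> M c -> ~ T c ->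
  exists U, [/\ clopen U, U c, forall t, T t -> ~ U t, Adm n U & Adm n (h @` U)].
Proof.
move=> [hK gK ch gh [cT _]] Mc nTc.
have gc := gh _ nTc.
have Mhc : M (h c) by move: gc => [N [_ Nc _ _ /(_ c Nc)[+ _]]]; exact.
have [N [oN Nc NA]] := Adm_local n Mc.
have [N' [oN' N'c NA']] := Adm_local n Mhc.
have [||U [cU UO Uc coU [_ hU _]]] := germ_restrict convex_nbhs gc (O := N `&` (~` T `&` h @^-1` N')).
- apply: openI => //; apply: openI; first by rewrite openC.
  by move/continuousP: ch; apply.
- by [].
exists U; split => //.
- by move=> t Tt /UO[_ []].
- by apply: NA => // x /UO[].
- by apply: NA'; [move=> _ [x /UO[_ [_ ?]] <-]|exact: hU].
Qed.

(** [h] is precomposed with a homeomorphism supported on [U] that moves [a] to [b]. Since it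
    preserves [U] and is the identity elsewhere, it sends no new point into [T], and germs compose
    at every point off [T] other than [a]. *)
Lemma extend_partial_sol n h g T U a b : partial_sol (h, g, T) ->
  clopen U -> (forall t, T t -> ~ U t) -> Adm n U -> Adm n (h @` U) ->
  U a -> U b -> D a -> E (h b) ->
  exists h' g' T', [/\ partial_sol (h', g', T'),
    extends n (h, g, T) (h', g', T'), T' a & h' a = h b].
Proof.
move=> [hK gK ch gh [cT TDE]] cU TU AU AhU Ua Ub Da Ehb.
have [F [G [FK GK cF Fa [FU UF Fg]]]] := move_point Meps cU Ua Ub.
exists (h \o F), (G \o g), (T `|` [set a]); split; last 2 first.
- by right.
- by rewrite /= Fa.
- split.
  + by apply: can_comp.
  + by apply: can_comp.
  + by move=> x; apply: continuous_comp; [exact: cF|exact: ch].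
  + move=> x nx; have xa : x <> a by move=> xa; apply: nx; right.
    apply: (germ_comp convex_nbhs); first exact: Fg.
    apply: gh => TFx; apply: nx; left.
    have [Ux|nUx] := pselect (U x); last by rewrite -(FU _ nUx).
    by case: (TU _ TFx); apply: UF.
  + split=> [|t].
      apply: closedU => //; apply: accessible_closed_set1.
      exact: hausdorff_accessible.
    case=> [Tt|->] /=; last by rewrite Fa.
    by rewrite FU; [exact: TDE|exact: TU].
- exists U; split => // [x /FU /= ->//|]; split=> [x /UF UFx|x Tx]; last by left.
  by exists (F x).
Qed.

(** Even stages treat the point of [D] numbered [n./2], odd stages the point of [E] numbered [n./2].
    Density of the other set supplies its partner inside the admissible neighbourhood. *)
Lemma next_partial_sol (fD fE : X -> nat) n st :
  {in D &, injective fD} -> {in E &, injective fE} -> partial_sol st ->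
  exists st', [/\ partial_sol st', extends n st st',
    forall x, D x -> fD x = n./2 -> ~~ odd n -> st'.2 x &
    forall y, E y -> fE y = n./2 -> odd n -> exists2 t, st'.2 t & st'.1.1 t = y].
Proof.
case: st => -[h g] T fDI fEI sol; have [hK gK ch gh [cT TDE]] := sol.
have [x0 _] := X2.
have [c [_ Dc]] := dD (ex_intro setT x0 Logic.I) openT.
(* If nothing is to be done, the modified set is empty; it is admissible because it lies in a
   neighbourhood of some point of [M]. *)
have stay : extends n (h, g, T) (h, g, T).
  have [N [_ _ NA]] := Adm_local n (DM Dc).
  have Mhc : M (h (g c)) by rewrite gK; exact: DM.
  by exists set0; rewrite image_set0; split => //; [apply: NA => //|apply: NA => //|move=> t _ []|split].
case: (boolP (odd n)) => [on|en].
- have [[y [Ey yn]]|ny] := pselect (exists y, E y /\ fE y = n./2); last first.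
    exists (h, g, T); split => // y Ey yn _; by case: ny; exists y.
  have uy z : E z -> fE z = n./2 -> z = y.
    by move=> Ez zn; apply: fEI; rewrite ?inE // zn.
  have [Tg|nTg] := pselect (T (g y)).
    exists (h, g, T); split => // z Ez zn _; exists (g y) => //=.
    by rewrite gK; exact: esym (uy _ Ez zn).
  have Mg : M (g y).
    have [N [_ Ny _ _ /(_ _ Ny)[_]]] := gh _ nTg.
    by rewrite gK; apply; exact: EM.
  have [U [cU Uy TU AU AhU]] := admissible_nbhs n sol Mg nTg.
  have [a [Ua Da]] := dD (ex_intro _ _ Uy) (proj1 cU).
  have [|h' [g' [T' [sol' ext T'a h'a]]]] :=
    extend_partial_sol sol cU TU AU AhU Ua Uy Da; first by rewrite gK.
  exists (h', g', T'); split => // z Ez zn _; exists a => //=.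
  by rewrite h'a gK; exact: esym (uy _ Ez zn).
- have [[x [Dx xn]]|nx] := pselect (exists x, D x /\ fD x = n./2); last first.
    exists (h, g, T); split => // x Dx xn _; by case: nx; exists x.
  have ux z : D z -> fD z = n./2 -> z = x.
    by move=> Dz zn; apply: fDI; rewrite ?inE // zn.
  have [Tx|nTx] := pselect (T x).
    by exists (h, g, T); split => // z Dz zn _; rewrite (ux z).
  have [U [cU Ux TU AU AhU]] := admissible_nbhs n sol (DM Dx) nTx.
  have [||b [Vb Eb]] := dE (O := g @^-1` U) _ _.
  - by exists (h x); rewrite /= hK.
  - have cg := continuous_inverse cX hX ch hK gK.
    by move/continuousP: cg; apply; case: cU.
  have [|h' [g' [T' [sol' ext T'a _]]]] :=
    extend_partial_sol sol cU TU AU AhU Ux Vb Dx; first by rewrite gK.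
  by exists (h', g', T'); split => // z Dz zn _; rewrite (ux z).
Qed.

Hypotheses (cD : countable D) (cE : countable E).
Hypothesis Adm_decided : forall x O, open O -> O x -> exists Q n,
  [/\ clopen Q, Q x, Q `<=` O &
    forall m V, (n <= m)%N -> Adm m V -> decided V Q].

(** All later modifications avoid [T n], so the limit agrees with [h n] there. Every point of [D]
    enters some [T n], and every point of [E] becomes the settled image of a point of some [T n]. *)
Lemma homogeneous_pair : exists f : X -> X, homeomorphism f /\ f @` D = E.
Proof.
have /countable_injP[fD fDI] := cD; have /countable_injP[fE fEI] := cE.
have step (p : nat * state) : exists st', partial_sol p.2 ->
    [/\ partial_sol st', extends p.1 p.2 st',
      forall x, D x -> fD x = p.1./2 -> ~~ odd p.1 -> st'.2 x &
      forall y, E y -> fE y = p.1./2 -> odd p.1 ->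
        exists2 t, st'.2 t & st'.1.1 t = y].
  have [|ns] := pselect (partial_sol p.2); last by exists p.2.
  by move=> /(next_partial_sol p.1 fDI fEI)[st' stP]; exists st'.
have [F FP] := choice step.
pose st := fix st n : state := if n is m.+1 then F (m, st m) else (id, id, set0).
have sol n : partial_sol (st n).
  elim: n => [|n IH]; last by have [] := FP (n, st n) IH.
  split => //; [by move=> x|by move=> x _; exact: germ_id|].
  by split; [exact: closed0|].
pose h n := (st n).1.1; pose g n := (st n).1.2; pose T n := (st n).2.
have stE n : st n = (h n, g n, T n) by rewrite /h /g /T; case: (st n) => -[].
have solP n : partial_sol (h n, g n, T n) by rewrite -stE.
have nextP n := FP (n, st n) (sol n).
have ext n : exists U, [/\ Adm n U, Adm n (h n @` U), forall t, T n t -> ~ U t,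
      forall x, ~ U x -> h n.+1 x = h n x &
      (forall x, U x -> (h n @` U) (h n.+1 x)) /\ T n `<=` T n.+1].
  have [_ + _ _] := nextP n.
  by rewrite /= (_ : F _ = st n.+1) // (stE n.+1) [X in extends _ X _]stE.
have [U UP] := choice ext.
have [||||||f hf fE'] := @limit_homeomorphism X cX hX h g U.
- by move=> n; have [] := solP n.
- by move=> n; have [] := solP n.
- by move=> n; have [] := solP n.
- by move=> n; have [] := UP n.
- by move=> n; have [_ _ _ _ []] := UP n.
- move=> x O oO Ox; have [Q [n [cQ Qx QO dQ]]] := Adm_decided oO Ox.
  by exists Q, n; split => // m nm; have [AU AhU _ _ _] := UP m; split; [exact: dQ AU|exact: dQ AhU].
have TS n m : (n <= m)%N -> T n `<=` T m.
  move=> /subnKC <-; elim: (m - n)%N => [|k IH]; first by rewrite addn0.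
  by rewrite addnS => x /IH; have [_ _ _ _ [_]] := UP (n + k)%N; apply.
have fT n t : T n t -> f t = h n t.
  move=> Tt; apply: fE' => m /subnKC <-.
  elim: (m - n)%N => [|k IH]; first by rewrite addn0.
  have [_ _ TU hU _] := UP (n + k)%N.
  by rewrite addnS hU //; apply: TU; apply: TS Tt; exact: leq_addr.
exists f; split => //; apply/seteqP; split=> [_ [x Dx <-]|y Ey].
- have [_ _ + _] := nextP (fD x).*2.
  move=> /(_ x Dx) /=; rewrite doubleK odd_double => /(_ erefl erefl) Tx.
  rewrite (fT (fD x).*2.+1) //.
  by have [_ _ _ _ [_ /(_ x Tx)[]]] := solP (fD x).*2.+1.
- have [_ _ _] := nextP (fE y).*2.+1.
  move=> /(_ y Ey) /=; rewrite uphalf_double odd_double => /(_ erefl erefl)[t Tt ty].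
  exists t; first by have [_ _ _ _ [_ /(_ t Tt)[]]] := solP (fE y).*2.+2.
  by rewrite (fT (fE y).*2.+2).
Qed.

End back_and_forth.

(** The images of one point under the countably many [eps s] are dense. For given [D] and [E],
    admissible sets are taken with respect to a countable saturation of their union. *)
Lemma self_similar_cdh :
  (forall M : set X, countable M -> exists Adm : nat -> set (set X),
    (forall n x, M x -> exists N,
      [/\ open N, N x & forall U, U `<=` N -> order_convex U -> Adm n U]) /\
    (forall x O, open O -> O x -> exists Q n, [/\ clopen Q, Q x, Q `<=` O &
      forall m V, (n <= m)%N -> Adm m V -> decided V Q])) ->
  countable_dense_homogeneous X.
Proof.
move=> admP; split.
  have [x0 _] := X2; exists (range (fun s => eps s x0)).
    by apply: countable_image; exact: countableP.
  move=> O O0 oO; have [s sO] := eps_dense oO O0.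
  by exists (eps s x0); split; [apply: sO; exists x0|exists s].
move=> D E cD dD cE dE.
have [|M [cM DEM Meps]] := @countable_saturation (D `|` E).
  exact: countable_setU.
have [Adm [loc dec]] := admP M cM.
by apply: (@homogeneous_pair D E M Adm) => // x ?; apply: DEM; [left|right].
Qed.

End self_similar.

(** * A Hausdorff gap and a lambda'-set *)

Section well_orders.
Variables (W : eqType) (R : rel W).
Hypothesis wR : well_order R.

Lemma wo_min (P : set W) : P !=set0 -> exists2 z, P z & forall y, P y -> R z y.
Proof.
move=> [x Px]; have [|z [[/asboolP Pz zP] _]] := wR (A := fun y => `[< P y >]).
  by exists x; apply/asboolP.
by exists z => // y Py; apply: zP; apply/asboolP.
Qed.

Lemma wo_total x y : R x y \/ R y x.
Proof.
have [|z [->|->] zP] := @wo_min [set x; y]; first by exists x; left.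
- by left; apply: zP; right.
- by right; apply: zP; left.
Qed.

Lemma wo_refl x : R x x. Proof. by case: (wo_total x x). Qed.

(** Both points are least in the set of the two, and [well_order] makes the least element unique. *)
Lemma wo_anti x y : R x y -> R y x -> x = y.
Proof.
move=> xy yx; have [|z [_ zP]] := wR (A := [pred z | (z == x) || (z == y)]).
  by exists x; rewrite inE eqxx.
have <- : z = x.
  apply: zP; split=> [|t]; first by rewrite inE eqxx.
  by rewrite !inE => /orP[] /eqP -> //; exact: wo_refl.
apply: zP; split=> [|t]; first by rewrite inE eqxx orbT.
by rewrite !inE => /orP[] /eqP -> //; exact: wo_refl.
Qed.

Lemma wo_trans x y z : R x y -> R y z -> R x z.
Proof.
move=> xy yz; have [|t [[->|->]|->] tP] := @wo_min [set x; y; z].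
- by exists x; left; left.
- by apply: tP; right.
- have yx : R y x by apply: tP; left; left.
  by rewrite (wo_anti xy yx).
- have zy : R z y by apply: tP; left; right.
  by rewrite -(wo_anti yz zy).
Qed.

Definition wo_lt y x := R y x /\ y <> x.

Lemma wo_ltNge x y : ~ wo_lt x y <-> R y x.
Proof.
split=> [nxy|yx [xy ne]]; last exact/ne/wo_anti.
have [xy|//] := wo_total x y; apply: contrapT => nyx; apply: nxy.
by split => // xyE; apply: nyx; rewrite xyE wo_refl.
Qed.

Lemma wo_lt_trans x y z : wo_lt x y -> wo_lt y z -> wo_lt x z.
Proof.
move=> [xy ne] [yz ne']; split; first exact: wo_trans yz.
by move=> xz; apply: ne; apply: wo_anti => //; rewrite xz.
Qed.

Lemma wo_lt_wf : well_founded wo_lt.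
Proof.
move=> x; apply: contrapT => nx.
have [|z nz zP] := @wo_min [set x | ~ Acc wo_lt x]; first by exists x.
apply: nz; constructor => y [yz ne]; apply: contrapT => ny.
by apply: ne; apply: wo_anti => //; exact: zP.
Qed.

(** Recursion with a choice at each step. [ex] extends the function known below [x] by the default
    [v0]; this is harmless because [good x] depends only on values below [x]. *)
Lemma transfinite_recursion (V : Type) (v0 : V) (good : W -> (W -> V) -> V -> Prop) :
  (forall x f g v, (forall y, wo_lt y x -> f y = g y) -> good x f v -> good x g v) ->
  (forall x f, (forall y, wo_lt y x -> good y f (f y)) -> exists v, good x f v) ->
  exists f, forall x, good x f (f x).
Proof.
move=> ext step.
pose ex x (rec : forall y, wo_lt y x -> V) y :=
  if pselect (wo_lt y x) is left yx then rec y yx else v0.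
pose F x (rec : forall y, wo_lt y x -> V) :=
  if pselect (exists v, good x (ex x rec) v) is left h then sval (cid h) else v0.
pose f := Fix wo_lt_wf (fun=> V) F.
have fE x : f x = F x (fun y _ => f y).
  apply: Fix_eq => {}x g h gh; congr (F x _).
  by apply: functional_extensionality_dep => y; apply: functional_extensionality_dep.
exists f => x; elim/(well_founded_ind wo_lt_wf): x => x IH.
have exf y : wo_lt y x -> ex x (fun y _ => f y) y = f y.
  by rewrite /ex; case: pselect.
rewrite fE /F; case: pselect => [h|[]]; first exact: ext exf (svalP (cid h)).
have [v gv] := step x f IH.
by exists v; apply: ext gv => y /exf.
Qed.

End well_orders.

(** * The first uncountable ordinal *)

Section omega1.
Variables (W : eqType) (R : rel W).
Hypothesis oR : omega1_well_order R.

Let wR : well_order R. Proof. by case: oR. Qed.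

Lemma omega1_unbounded (S : set W) : ~ countable S -> forall x, exists2 y, S y & wo_lt R x y.
Proof.
move=> nS x; apply: contrapT => nx; apply: nS.
have [_ _ /(_ x)] := oR; apply: sub_countable; apply: subset_card_le => y Sy.
by apply: contrapT => nyx; apply: nx; exists y => //; apply: contrapT => /(wo_ltNge wR).
Qed.

Lemma omega1_sup (S T : set W) : countable S -> ~ countable T ->
  exists2 y, T y & forall x, S x -> wo_lt R x y.
Proof.
move=> cS nT; apply: contrapT => ny; apply: nT.
have : countable (\bigcup_(x in S) [set y | R y x]).
  by apply: bigcup_countable => // x _; case: oR.
apply: sub_countable; apply: subset_card_le => y Ty.
apply: contrapT => nyS; apply: ny; exists y => // x Sx.
by apply: contrapT => /(wo_ltNge wR) yx; apply: nyS; exists x.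
Qed.

Lemma countable_wo_lt x : countable [set y | wo_lt R y x].
Proof.
have [_ _ /(_ x)] := oR; apply: sub_countable; apply: subset_card_le.
by move=> y [].
Qed.

End omega1.

Lemma uncountable_seq : ~ countable [set: nat -> bool].
Proof.
move=> /countable_injP[f fI].
pose b n := `[< exists2 x : nat -> bool, f x = n & ~~ x n >].
have [bf|nbf] := boolP (b (f b)); last first.
  by case/negP: (nbf); apply/asboolP; exists b.
have /asboolP[x fx nx] := bf; case/negP: nx.
have xb : x = b by apply: fI; rewrite ?inE.
by rewrite xb.
Qed.

(** Take the points with countable initial segment in a well order of [nat -> bool]. Were there only
    countably many, the least point outside them would have a countable initial segment too. *)
Lemma omega1_exists : exists (W : eqType) (R : rel W), omega1_well_order R.
Proof.
pose T : eqType := (nat -> bool : choiceType).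
have [R wR] := well_ordering_principle T.
pose P : pred T := fun y => `[< countable [set z | R z y] >].
have cval (S : set T) : countable S -> countable [set y : {y | P y} | S (val y)].
  move=> /countable_injP[f fI]; apply/countable_injP.
  exists (fun y => f (val y)) => x y; rewrite !inE => Sx Sy e.
  by apply: val_inj; apply: fI; rewrite ?inE.
exists {y : T | P y}, (relpre val R); split.
- move=> A [x Ax].
  have [|z [w Aw wz] zP] := @wo_min _ _ wR (val @` [set` A]).
    by exists (val x), x.
  exists w; split=> [|w' [Aw' w'P]].
    by split => // y Ay /=; rewrite wz; apply: zP; exists y.
  apply: val_inj; apply: (wo_anti wR); last exact: w'P.
  by rewrite wz; apply: zP; exists w'.
- move=> cP; have cT : countable (P : set T).
    rewrite (_ : (P : set T) = val @` [set: {y : T | P y}]).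
      exact: countable_image.
    apply/seteqP; split=> [y Py|_ [[y Py] _ <-] //].
    by exists (exist _ y Py).
  have [x nPx] : exists x, ~ P x.
    apply: contrapT => nx; apply: uncountable_seq.
    apply: (sub_countable _ cT); apply: subset_card_le => x _.
    by apply: contrapT => nPx; apply: nx; exists x.
  have [|z nPz zP] := @wo_min _ _ wR (fun x => ~ P x); first by exists x.
  apply: nPz; apply/asboolP.
  have : countable ((P : set T) `|` [set z]) by exact: countable_setU.
  apply: sub_countable; apply: subset_card_le => y yz.
  have [Py|/zP zy] := pselect (P y); [by left|right].
  exact: (wo_anti wR).
- by move=> x; have /asboolP := valP x; exact: cval.
Qed.

(** * Inclusion modulo finite sets *)

Definition almost (A B : set nat) := exists n, forall m, (n <= m)%N -> A m -> B m.

Definition unbounded (A : set nat) := forall n, exists2 m, (n <= m)%N & A m.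

Lemma almost_trans A B C : almost A B -> almost B C -> almost A C.
Proof.
move=> [n AB] [k BC]; exists (maxn n k) => m; rewrite geq_max => /andP[nm km] Am.
by apply: BC => //; exact: AB.
Qed.

Lemma almost_sub A B : A `<=` B -> almost A B.
Proof. by move=> AB; exists 0 => m _; exact: AB. Qed.

Lemma almostU A B C : almost A C -> almost B C -> almost (A `|` B) C.
Proof.
move=> [n AC] [k BC]; exists (maxn n k) => m; rewrite geq_max => /andP[nm km].
by case; [exact: AC|exact: BC].
Qed.

Lemma finite_set_injective (T : Type) (S : set T) (c : T -> nat) n :
  {in S &, injective c} -> finite_set [set y | S y /\ (c y <= n)%N].
Proof.
move=> cI; pose D := [set y | S y /\ (c y <= n)%N].
have /eq_finite_set <- : (c @` D #= D)%card.
  by apply: inj_card_eq => x y; rewrite !inE => -[Sx _] [Sy _]; apply: cI; rewrite inE.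
by apply: (sub_finite_set _ (finite_II n.+1)) => _ [y [_ yn] <-] /=; rewrite ltnS.
Qed.

Lemma finite_set_nat_bound (S : set nat) :
  finite_set S -> exists n, forall m, S m -> (m < n)%N.
Proof.
move=> /finite_seqP[s ->]; exists (\max_(i <- s) i).+1 => m /= ms.
by rewrite ltnS; exact: (@leq_bigmax_seq _ s xpredT id).
Qed.

(** * Construction of a Hausdorff gap *)

Section gap_step.
Variables (W : eqType) (R : rel W).
Hypothesis oR : omega1_well_order R.
Local Notation lt := (wo_lt R).

Let wR : well_order R. Proof. by case: oR. Qed.

(* The last clause is Hausdorff's condition: it is what prevents a set from
   separating the two towers. *)
Definition gap_at (x : W) (f : W -> set nat * set nat) (v : set nat * set nat) :=
  [/\ forall m, v.1 m -> ~ v.2 m,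
    unbounded (~` (v.1 `|` v.2)), unbounded v.2,
    forall y, lt y x -> [/\ almost (f y).1 v.1, almost (f y).2 v.2 &
      unbounded (v.2 `\` ((f y).1 `|` (f y).2))] &
    forall n, finite_set [set y | lt y x /\ forall m, v.1 m -> (f y).2 m -> (m < n)%N]].

Section step.
Variables (x : W) (f : W -> set nat * set nat).
Hypothesis fP : forall y, lt y x -> gap_at y f (f y).

Let P := [set y | lt y x].
Let A y := (f y).1.
Let B y := (f y).2.
Let U y := A y `|` B y.

Variable c : W -> nat.
Hypothesis cI : {in P &, injective c}.

Let AB y z : P y -> P z -> almost (A y) (~` B z).
Proof.
move=> Py Pz; have [dy _ _ yP _] := fP Py; have [dz _ _ zP _] := fP Pz.
have [->|yz] := eqVneq y z; first by exists 0 => m _ /dz.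
have [ryz|rzy] := wo_total wR y z.
- have [|[n h] _ _] := zP y; first by split => //; exact/eqP.
  by exists n => m nm Am; apply: dz; exact: h.
- have [|_ [n h] _] := yP z; first by split => //; apply/eqP; rewrite eq_sym.
  by exists n => m nm Am Bm; apply: (dy m Am); exact: h.
Qed.

Let U_mono y z : P y -> P z -> R y z -> almost (U y) (U z).
Proof.
move=> Py Pz yz; have [_ _ _ zP _] := fP Pz.
have [->|ne] := eqVneq y z; first exact: almost_sub.
have [|hA hB _] := zP y; first by split => //; exact/eqP.
apply: almostU; [apply: almost_trans hA _|apply: almost_trans hB _].
- by apply: almost_sub; left.
- by apply: almost_sub; right.
Qed.

(** As [c] is injective on [P], only finitely many points are numbered below [k], and a maximum of
    their bounds exists. *)
Let bound (Phi : W -> nat -> Prop) k :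
  (forall y, P y -> (c y < k)%N -> exists n, forall m, (n <= m)%N -> Phi y m) ->
  exists n, forall y, P y -> (c y < k)%N -> forall m, (n <= m)%N -> Phi y m.
Proof.
elim: k => [|k IH] h; first by exists 0.
have [n nP] : exists n, forall y, P y -> (c y < k)%N -> forall m, (n <= m)%N -> Phi y m.
  by apply: IH => y Py yk; apply: h => //; exact: leqW.
have [[y [Py yk]]|ny] := pselect (exists y, P y /\ c y = k); last first.
  exists n => y Py; rewrite ltnS leq_eqVlt => /predU1P[yk|]; last exact: nP.
  by case: ny; exists y.
have [|n' n'P] := h y Py; first by rewrite yk.
exists (maxn n n') => z Pz + m; rewrite geq_max => + /andP[nm n'm].
rewrite ltnS leq_eqVlt => /predU1P[zk|zk]; last exact: (nP z).
by rewrite (_ : z = y); [exact: n'P|apply: cI; rewrite ?inE // zk yk].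
Qed.

(** In the first case no point of [Q] is numbered below [k]. Otherwise [z] is the [R]-greatest of
    these finitely many points. *)
Let last_of (Q : set W) k : (forall y, P y -> Q y -> (k <= c y)%N) \/
  exists2 z, P z /\ Q z & exists n, forall y, P y -> Q y -> (c y < k)%N ->
    forall m, (n <= m)%N -> U y m -> U z m.
Proof.
have [|nk] := pselect (exists y, [/\ P y, Q y & (c y < k)%N]); last first.
  by left => y Py Qy; rewrite leqNgt; apply/negP => yk; apply: nk; exists y.
move=> h; right.
suff [z [Pz Qz] zP] : exists2 z, P z /\ Q z &
    forall y, P y -> Q y -> (c y < k)%N -> R y z.
  exists z => //; pose Phi y m := Q y -> U y m -> U z m.
  have [|n nP] := bound (Phi := Phi) (k := k).
    move=> y Py yk; have [Qy|nQ] := pselect (Q y); last by exists 0 => m _ /nQ.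
    by have [n nP] := U_mono Py Pz (zP y Py Qy yk); exists n => m nm _; exact: nP.
  by exists n => y Py Qy yk m nm; exact: (nP y Py yk).
elim: k h => [[y []]//|k IH [y [Py Qy yk]]].
have [h|nh] := pselect (exists y, [/\ P y, Q y & (c y < k)%N]); last first.
  exists y => // z Pz Qz; rewrite ltnS leq_eqVlt => /predU1P[zk|zk]; last first.
    by case: nh; exists z.
  move: yk; rewrite ltnS leq_eqVlt => /predU1P[yk|yk]; last by case: nh; exists y.
  by rewrite (_ : z = y) ?wo_refl //; apply: cI; rewrite ?inE // zk yk.
have [z [Pz Qz] zP] := IH h.
have [[t [Pt Qt tk]]|nt] := pselect (exists t, [/\ P t, Q t & c t = k]); last first.
  exists z => // t Pt Qt; rewrite ltnS leq_eqVlt => /predU1P[tk|]; last exact: zP.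
  by case: nt; exists t.
have tE t' : P t' -> c t' = k -> t' = t.
  by move=> Pt' e; apply: cI; rewrite ?inE // tk.
have [zt|tz] := wo_total wR z t.
- exists t => // t' Pt' Qt'; rewrite ltnS leq_eqVlt => /predU1P[/tE->//|t'k].
    exact: wo_refl.
  exact: (wo_trans wR (zP _ Pt' Qt' t'k)).
- exists z => // t' Pt' Qt'; rewrite ltnS leq_eqVlt => /predU1P[/tE->//|t'k].
  exact: zP.
Qed.

(** A sparse sequence [r], almost disjoint from all earlier sets, is set aside: its even terms stay
    out of both new sets, its odd terms go to [B'], which yields the unboundedness clauses. [C]
    almost contains the earlier first sets, [A'] adds the points [p b] to it, and [B'] is all the
    rest. *)
Lemma gap_step : exists v, gap_at x f v.
Proof.
have [r [rS rU]] : exists r : nat -> nat, (forall k, (r k < r k.+1)%N) /\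
    forall k y, P y -> (c y < k)%N -> ~ U y (r k).
  have pick (p : nat * nat) : exists m, (p.2 <= m)%N /\
      forall y, P y -> (c y < p.1)%N -> ~ U y m.
    case: p => k n /=; have [h|[z [Pz _] [N NP]]] := last_of setT k.
      by exists n; split => // y Py; rewrite ltnNge h.
    have [_ uz _ _ _] := fP Pz; have [m] := uz (maxn n N).
    rewrite geq_max => /andP[nm Nm] nU; exists m; split => // y Py yk Uy.
    by apply: nU; exact: NP Uy.
  have [g gP] := choice pick.
  pose r := fix r k := if k is j.+1 then g (j.+1, (r j).+1) else g (0, 0).
  exists r; split=> [k|[|k] y Py yk //]; first by have [] := gP (k.+1, (r k).+1).
  by have [_ h] := gP (k.+1, (r k).+1); exact: h.
have r_mono : {mono r : i j / (i <= j)%N}.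
  by apply: leq_mono; apply: homo_ltn => //; exact: ltn_trans.
have rI i j : r i = r j -> i = j.
  by move=> e; apply/eqP; rewrite eqn_leq -(r_mono i j) -(r_mono j i) e leqnn.
have r_ge k : (k <= r k)%N by elim: k => // k IH; exact: leq_ltn_trans (rS k).
pose Rm := range r.
pose R0 := range (fun k => r k.*2).
have RU y : P y -> almost (U y) (~` Rm).
  move=> Py; exists (r (c y)).+1 => m rm Uy [k _ rk].
  have [/rU|kc] := ltnP (c y) k; first by move=> /(_ Py); rewrite rk.
  by move: rm; rewrite -rk ltnNge r_mono kc.
(* Any [g] with [c g < kk b] lies below [b], so finitely many such [U g] do not
   almost cover [B b] and [p b] exists.  When [C] meets [B b] only below [kk b],
   the point [p b] is added to [C], which restores Hausdorff's condition. *)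
have exkk b : exists k, P b -> (exists2 g, P g /\ R b g & c g = k) /\
    (forall g, P g -> R b g -> (k <= c g)%N).
  have [Pb|nPb] := pselect (P b); last by exists 0.
  pose S := fun k => `[< exists2 g, P g /\ R b g & c g = k >].
  have exS : exists k, S k.
    by exists (c b); apply/asboolP; exists b => //; split => //; exact: wo_refl.
  exists (ex_minn exS) => _; case: ex_minnP => k /asboolP Sk kS; split => // g Pg bg.
  by apply: kS; apply/asboolP; exists g.
have [kk kkP] := choice exkk.
have exp b : exists m, P b -> [/\ B b m, (kk b <= m)%N, ~ Rm m &
    forall g, P g -> (c g < kk b)%N -> ~ U g m].
  have [Pb|nPb] := pselect (P b); last by exists 0.
  have [_ kb] := kkP b Pb.
  have ltb g : P g -> (c g < kk b)%N -> lt g b.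
    by move=> Pg; rewrite ltnNge => /negP h; apply: contrapT => /(wo_ltNge wR)/(kb _ Pg).
  have [n nP] := RU b Pb; have [_ _ uB bP _] := fP Pb.
  have [h|[z [Pz zb] [N NP]]] := last_of (fun g => lt g b) (kk b).
    have [m] := uB (maxn n (kk b)); rewrite geq_max => /andP[nm km] Bm.
    exists m => _; split => // [|g Pg gk]; first by apply: nP => //; right.
    by have := h g Pg (ltb g Pg gk); rewrite leqNgt gk.
  have [_ _ /(_ (maxn N (maxn n (kk b))))[m]] := bP z zb.
  rewrite !geq_max => /and3P[Nm nm km] [Bm nU].
  exists m => _; split => // [|g Pg gk]; first by apply: nP => //; right.
  by move=> Ug; apply: nU; apply: (NP g) => //; exact: ltb.
have [p pP] := choice exp.
(* Only a bounded part of [A b] is discarded. Conversely [B y] meets [C] in a bounded set, because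
   only the [b] numbered before [y] contribute. *)
pose C m := exists2 b, P b & [/\ A b m, forall g, P g -> (c g <= c b)%N -> ~ B g m & ~ Rm m].
pose J b := P b /\ forall m, C m -> B b m -> (m < kk b)%N.
pose A' m := C m \/ exists2 b, J b & m = p b.
pose B' m := ~ A' m /\ ~ R0 m.
have A'R m : A' m -> ~ Rm m.
  by case=> [[b _ [_ _]]//|[b [Pb _] ->]]; have [] := pP b Pb.
have AC y : P y -> almost (A y) C.
  move=> Py; have [n nP] := RU y Py.
  have [|N NP] := bound (Phi := fun g m => A y m -> ~ B g m) (k := (c y).+1).
    by move=> g Pg _; exact: AB.
  exists (maxn n N) => m; rewrite geq_max => /andP[nm Nm] Am; exists y => //.
  by split => // [g Pg gy|]; [exact: (NP g Pg _ m)|by apply: nP => //; left].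
(* For each of the finitely many [g], [A g] is almost contained in [C], so Hausdorff's condition at
   [g] leaves finitely many [b] below [g]. *)
have near n n' : finite_set [set b | [/\ P b, forall m, C m -> B b m -> (m < n)%N &
    exists2 g, P g /\ R b g & (c g <= n')%N]].
  apply: (@sub_finite_set _ _ (\bigcup_(g in [set g | P g /\ (c g <= n')%N])
      [set b | [/\ P b, R b g & forall m, C m -> B b m -> (m < n)%N]])).
    by move=> b [Pb Cb [g [Pg bg] gn]]; exists g.
  apply: bigcup_finite; first exact: finite_set_injective.
  move=> g [Pg _]; have [N NP] := AC g Pg; have [_ _ _ _ /(_ (maxn n N)) fin] := fP Pg.
  have : finite_set ([set b | lt b g /\ forall m, A g m -> (f b).2 m -> (m < maxn n N)%N] `|` [set g]).
    by rewrite finite_setU; split.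
  apply: sub_finite_set => b [Pb bg Cb]; have [->|bneg] := eqVneq b g; [by right|left].
  split=> [|m Am Bm]; first by split => //; exact/eqP.
  rewrite leq_max; have [//|Nm /=] := ltnP m N; first by rewrite orbT.
  by rewrite orbF; apply: Cb => //; exact: NP.
have BC y : P y -> almost (B y) (~` C).
  move=> Py; have [|N NP] := bound (Phi := fun g m => A g m -> ~ B y m) (k := c y).
    by move=> g Pg _; exact: AB.
  exists N => m Nm By [b Pb [Ab nB _]].
  have [cyb|cby] := leqP (c y) (c b); first by case: (nB y).
  by case: (NP b Pb cby m Nm Ab).
(* Finitely many [b] in [J] have [kk b] at most [c y], by [near]; for the others [p b] was chosen
   outside [U y]. *)
have Bp y : P y -> almost (B y) [set m | forall b, J b -> m <> p b].
  move=> Py; pose S := [set b | J b /\ (kk b <= c y)%N].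
  have /(finite_image p)/finite_set_nat_bound[n nP] : finite_set S.
    apply: sub_finite_set (near (c y) (c y)) => b [[Pb Jb] ky]; split => // [m Cm Bm|].
      exact: leq_trans (Jb m Cm Bm) ky.
    by have [[g [Pg bg] gk] _] := kkP b Pb; exists g => //; rewrite gk.
  exists n => m nm Bm b Jb mb; have [Pb _] := Jb.
  have [kc|ck] := leqP (kk b) (c y).
    have /nP : (p @` S) m by exists b.
    by rewrite ltnNge nm.
  by have [_ _ _ /(_ y Py ck)] := pP b Pb; apply; right; rewrite -mb.
have R1B' k : B' (r k.*2.+1).
  split; first by move=> /A'R; apply; exists k.*2.+1.
  by move=> [j _ /rI/(congr1 odd)]; rewrite /= !odd_double.
exists (A', B'); split => /=.
- by move=> m Am [].
- move=> n; exists (r n.*2); first by apply: leq_trans (r_ge _); rewrite -addnn leq_addr.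
  case=> [/A'R|[_]]; first by apply; exists n.*2.
  by apply; exists n.
- move=> n; exists (r n.*2.+1) => //.
  by apply: leq_trans (r_ge _); rewrite -addnn; exact/leqW/leq_addr.
- move=> y Py; split.
  + by apply: almost_trans (AC y Py) _; apply: almost_sub; left.
  + have [n1 P1] := BC y Py; have [n2 P2] := Bp y Py; have [n3 P3] := RU y Py.
    exists (maxn n1 (maxn n2 n3)) => m; rewrite !geq_max => /and3P[m1 m2 m3] Bm.
    split=> [[|[b Jb]]|]; [exact: P1|exact: P2|].
    by move=> [k _ rk]; apply: (P3 m m3 (or_intror Bm)); exists k.*2.
  + move=> n; pose k := maxn n (c y); have nk : (n <= k)%N by rewrite leq_maxl.
    have ck : (c y <= k)%N by rewrite leq_maxr.
    exists (r k.*2.+1).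
      by apply: leq_trans (r_ge _); rewrite -addnn; apply/leqW/(leq_trans nk)/leq_addr.
    split=> //; apply: (rU _ y) => //; rewrite ltnS -addnn.
    exact/(leq_trans ck)/leq_addr.
- move=> n; apply: sub_finite_set (near n n) => y [Py Hy]; split => // [m Cm|].
    by apply: Hy; left.
  have [[g [Pg yg] gk] _] := kkP y Py; have [By kp _ _] := pP y Py.
  (* If [n < kk y], then [y] is in [J], and [p y], which is at least [kk y], is a common point of
     [A'] and [B y] not below [n]. *)
  exists g => //; rewrite gk leqNgt; apply/negP => nk.
  have [Jy|nJ] := pselect (J y).
    have : (p y < n)%N by apply: Hy By; right; exists y.
    by rewrite ltnNge (leq_trans (ltnW nk) kp).
  apply: nJ; split => // m Cm Bm; apply: leq_trans (ltnW nk).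
  by apply: Hy Bm; left.
Qed.

End step.

(** A set separating all pairs would do so from the same [k] on for uncountably many indices.
    Infinitely many of these lie below another one, [x], and the first set at [x] meets their second
    sets only below [k], against Hausdorff's condition. *)
Lemma hausdorff_gap : exists A B : W -> set nat,
  [/\ forall x m, A x m -> ~ B x m,
    forall x, unbounded (B x) /\ unbounded (~` B x),
    forall x y, R y x -> almost (A y) (A x) /\ almost (B y) (B x),
    forall x y, lt y x -> exists2 m, B x m & ~ B y m &
    forall C : set nat, exists x, ~ exists n, forall m, (n <= m)%N ->
      (A x m -> C m) /\ (B x m -> ~ C m)].
Proof.
have [||f fP] := @transfinite_recursion _ _ wR _ (set0, set0) gap_at.
- move=> x f g v fg [v1 v2 v3 v4 v5]; split => // [y yx|n].
    by rewrite -fg //; exact: v4.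
  apply: sub_finite_set (v5 n) => y [yx Hy]; split => // m.
  by rewrite (fg y yx); exact: Hy.
- move=> x f fP; have /countable_injP[c cI] := countable_wo_lt oR x.
  exact: gap_step fP _ cI.
exists (fun x => (f x).1), (fun x => (f x).2).
have dis x m : (f x).1 m -> ~ (f x).2 m by have [h _ _ _ _] := fP x; exact: h.
split => //.
- move=> x; have [_ u1 u2 _ _] := fP x; split => // n.
  by have [m nm h] := u1 n; exists m => // Bm; apply: h; right.
- move=> x y yx; have [->|ne] := eqVneq y x; first by split; exact: almost_sub.
  by have [_ _ _ h _] := fP x; have [|] := h y; first by split => //; exact/eqP.
- move=> x y yx; have [_ _ _ h _] := fP x; have [_ _ u] := h y yx.
  by have [m _ [Bm nU]] := u 0; exists m => // By; apply: nU; right.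
move=> C; apply: contrapT => nC.
have sep x : exists n, forall m, (n <= m)%N ->
    ((f x).1 m -> C m) /\ ((f x).2 m -> ~ C m).
  by apply: contrapT => nx; apply: nC; exists x.
have [n nP] := choice sep.
have [k nk] : exists k, ~ countable [set x | n x = k].
  apply: contrapT => ck; have [_ cW _] := oR; apply: cW.
  rewrite (_ : [set: W] = \bigcup_k [set x | n x = k]).
    by apply: bigcup_countable => // k _; apply: contrapT => h; apply: ck; exists k.
  by apply/seteqP; split => // x _; exists (n x).
have exs x : exists y, n y = k /\ lt x y.
  by have [y ny xy] := omega1_unbounded oR nk x; exists y.
have [s sP] := choice exs.
have [x0 _] : exists x, [set x | n x = k] x.
  by apply/set0P/eqP => e; apply: nk; rewrite e; exact: countable0.
pose j m := iter m.+1 s x0.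
have jlt : {homo j : a b / (a < b)%N >-> lt a b}.
  by apply: homo_ltn => [y x z|i]; [exact: wo_lt_trans|have [] := sP (j i)].
have jI : injective j.
  move=> a b e; have [/jlt|/jlt|//] := ltngtP a b; by rewrite e => -[].
have [|x nx jx] := omega1_sup oR (S := range j) _ nk; first exact: countable_image.
have [_ _ _ _ /(_ k) fin] := fP x; apply: infinite_nat.
have /eq_finite_set <- : (range j #= [set: nat])%card.
  by apply: inj_card_eq => a b _ _; exact: jI.
apply: sub_finite_set fin => _ [m _ <-]; split; first by apply: jx; exists m.
move=> i Ai Bi; rewrite ltnNge; apply/negP => ki.
have nj : n (j m) = k by have [] := sP (iter m s x0).
have [|h _] := nP x i; first by rewrite nx.
by have [|_] := nP (j m) i; [rewrite nj|move=> /(_ Bi); apply; exact: h].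
Qed.

End gap_step.

(* Closedness in the product topology of [nat -> bool]. *)
Definition prefix_closed (K : set (nat -> bool)) := forall x,
  (forall n, exists2 y, K y & forall m, (m < n)%N -> x m = y m) -> K x.

(** [c x] is the complement of [B x]. Every [s] in [D] fails to separate the pair at some index
    [w s]; if [g] is above all these, no member of [D] separates the pair at [g], whereas [c x] does
    for all [x] from [g] on. The remaining indices are countably many. *)
Lemma lambda_prime_set (W : eqType) (R : rel W) : omega1_well_order R ->
  exists c : W -> nat -> bool, [/\ injective c,
    forall x b n, exists2 m, (n <= m)%N & c x m = b &
    forall D : set (nat -> bool), countable D ->
      exists K : nat -> set (nat -> bool), [/\ forall n, prefix_closed (K n),
        forall n x, K n x -> ~ D x & forall x, D (c x) \/ exists n, K n (c x)]].
Proof.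
move=> oR; have wR : well_order R by case: oR.
have [A [B [dis uB mono strict gap]]] := hausdorff_gap oR.
pose c x m := `[< ~ B x m >].
exists c; split.
- move=> x y e; apply: contrapT => ne.
  wlog yx : x y e ne / R y x.
    move=> h; have [xy|yx] := wo_total wR x y; last exact: h yx.
    by apply: (h y x) => // yx; exact: ne.
  have [m Bx nBy] := strict x y (conj yx (fun yx => ne (esym yx))).
  have : c y m by apply/asboolP.
  by rewrite -e => /asboolP.
- move=> x b n; have [u1 u2] := uB x; case: b.
    by have [m nm h] := u2 n; exists m => //; apply/asboolP.
  by have [m nm h] := u1 n; exists m => //; apply/asboolPn; rewrite not_notE.
- move=> D cD.
  pose H x n := [set s : nat -> bool | forall m, (n <= m)%N -> (A x m -> s m) /\ (B x m -> ~ s m)].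
  have Hc x n : prefix_closed (H x n).
    move=> s sH m nm; have [t Ht ->//] := sH m.+1; exact: Ht.
  have exw (s : nat -> bool) : exists w, forall n, ~ H w n s.
    by have [x nx] := gap s; exists x => n Hn; apply: nx; exists n; exact: Hn.
  have [w wP] := choice exw.
  have [_ nW _] := oR.
  have [g _ gP] := omega1_sup oR (countable_image w cD) nW.
  have /countable_injP[k kI] : countable [set x | R x g] by case: oR.
  (* Even numbers give the closed sets of separators at [g]; odd numbers give singletons [c x]
     outside [D] with [x] up to [g], or the empty set. *)
  exists (fun n => if odd n then [set s | exists x, [/\ s = c x, R x g, k x = n./2 & ~ D s]]
     else H g n./2); split.
  + move=> n; case: (odd n) => // s sK.
    have [_ [x [-> Rx kx nD]] _] := sK 0; suff sx : s = c x.
      by exists x; rewrite sx.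
    apply/funext => m; have [_ [y [-> Ry ky _]] ->//] := sK m.+1.
    by congr (c _ m); apply: kI; rewrite ?inE // kx ky.
  + move=> n s; case: (odd n) => [[x [_ _ _ //]]|Hs Ds].
    have [wg _] : wo_lt R (w s) g by apply: gP; exists s.
    have [[n1 h1] [n2 h2]] := mono _ _ wg; apply: (wP s (maxn n./2 (maxn n1 n2))).
    move=> m; rewrite !geq_max => /and3P[nm nm1 nm2]; have [HA HB] := Hs m nm.
    by split=> [Am|Bm]; [apply/HA/h1|apply/HB/h2].
  + move=> x; have [Dx|nDx] := pselect (D (c x)); [by left|right].
    have [xg|gx] := wo_total wR x g.
      by exists (k x).*2.+1; rewrite /= odd_double uphalf_double /=; exists x.
    have [[n1 h1] [n2 h2]] := mono _ _ gx.
    exists (maxn n1 n2).*2; rewrite odd_double doubleK => m.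
    rewrite geq_max => /andP[nm1 nm2]; split=> [Am|Bm].
      by apply/asboolP; apply: dis; exact: h1.
    by move/asboolP; apply; exact: h2.
Qed.

(** * The split Cantor space *)

(** An ultrafilter converges to the supremum of the points whose closed upper ray belongs to it. *)
Lemma order_complete_compact {d : Order.disp_t} {X : orderTopologicalType d} :
  (forall S : set X, exists s : X, (forall x, S x -> (x <= s)%O) /\
     forall b, (forall x, S x -> (x <= b)%O) -> (s <= b)%O) ->
  compact [set: X].
Proof.
move=> sup; rewrite compact_ultra => F UF _.
have [c [ub lub]] := sup [set x | F [set z | (x <= z)%O]].
exists c; split => // O; rewrite {1}itv_nbhsE => -[i [io ci] iO].
have FU : Filter F by exact: filter_filter.
apply: filterS iO _.
have left_ray l : (l < c)%O -> F [set z | (l < z)%O].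
  move=> lc; apply: contrapT => nF.
  have : (c <= l)%O; last by rewrite leNgt lc.
  apply: lub => x Fx; rewrite leNgt; apply/negP => lx; apply: nF.
  by apply: filterS Fx => z /=; exact: lt_le_trans.
have right_ray r : (c < r)%O -> F [set z | (z < r)%O].
  move=> cr; have [Fr|] := in_ultra_setVsetC [set z | (r <= z)%O] UF.
    by have := ub r Fr; rewrite leNgt cr.
  by apply: filterS => z /= /negP; rewrite ltNge.
case: i io ci => [[[] l|[]] [[] r|[]]] //= _; rewrite in_itv /= ?andbT.
- move=> /andP[/left_ray Fl /right_ray Fr].
  by apply: filterS2 Fl Fr => z lz zr; rewrite /= in_itv /= lz.
- by move=> /left_ray; apply: filterS => z lz; rewrite /= in_itv /= lz.
- by move=> /right_ray; apply: filterS => z lz; rewrite /= in_itv /= lz.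
- by move=> _; apply: filterS filterT => z _; rewrite /= in_itv.
Qed.

(** Replacing each index by a copy of [nat] keeps initial segments countable. The pairs give room to
    code the countably many basic sets attached to each index. *)
Lemma omega1_prod_nat (W : eqType) (R : rel W) : omega1_well_order R ->
  omega1_well_order (fun x y : W * nat =>
    if x.1 == y.1 then (x.2 <= y.2)%N else R x.1 y.1).
Proof.
move=> oR; have [wR nW cR] := oR; split.
- move=> S [x Sx].
  have [|w [[u n] Su /= uw] wP] := wo_min wR (P := fst @` [set` S]).
    by exists x.1, x.
  pose Q n := (w, n) \in S.
  have exQ : exists n, Q n by exists n; rewrite /Q -uw.
  exists (w, ex_minn exQ); case: ex_minnP => m Qm mP.
  have low y : y \in S -> if w == y.1 then (m <= y.2)%N else R w y.1.
    case: eqP => [wy|_] Sy; last by apply: wP; exists y.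
    by apply: mP; rewrite /Q wy; case: y Sy {wy}.
  split=> [|[w' m'] [Sw' w'P]]; first by split => // y; exact: low.
  have := low _ Sw'; have := w'P _ Qm; rewrite /= eq_sym.
  case: eqP => [<-|ne] h1 h2; first by congr pair; apply/eqP; rewrite eqn_leq h1 h2.
  by case: ne; exact: (wo_anti wR).
- move=> cW; apply: nW; rewrite (_ : [set: W] = fst @` [set: W * nat]).
    exact: countable_image.
  by apply/seteqP; split => // w _; exists (w, 0).
- move=> [w n]; apply: (@sub_countable _ _ _ ([set y | R y w] `*` [set: nat])).
    apply: subset_card_le => -[u m] /= h; split => //=.
    by move: h; case: eqP => [-> _|//]; exact: (wo_refl wR).
  exact: countableX.
Qed.

(** * Finite prefixes and the lexicographic order on sequences *)

Definition prepend (s : seq bool) (x : nat -> bool) : nat -> bool :=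
  fun n => if (n < size s)%N then nth false s n else x (n - size s)%N.

Lemma prepend_nth s x n : (n < size s)%N -> prepend s x n = nth false s n.
Proof. by rewrite /prepend => ->. Qed.

Lemma prepend_add s x n : prepend s x (size s + n) = x n.
Proof. by rewrite /prepend ltnNge leq_addr addKn. Qed.

Lemma prepend_mkseq x n : prepend (mkseq x n) (fun m => x (n + m)%N) = x.
Proof.
apply/funext => m; rewrite /prepend size_mkseq.
by case: ltnP => [mn|nm]; [rewrite nth_mkseq|rewrite subnKC].
Qed.

Definition lex (x y : nat -> bool) :=
  exists n, [/\ forall m, (m < n)%N -> x m = y m, x n = false & y n = true].

Lemma lex_prepend s x y : lex x y -> lex (prepend s x) (prepend s y).
Proof.
move=> [n [xy xn yn]]; exists (size s + n)%N; rewrite !prepend_add; split => // m mn.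
rewrite /prepend; case: ltnP => // sm; apply: xy.
by rewrite -(ltn_add2l (size s)) subnKC.
Qed.

Lemma lex_first x y : x <> y -> lex x y \/ lex y x.
Proof.
move=> xy; have ex : exists n, x n != y n.
  by apply: contrapT => h; apply: xy; apply/funext => n; apply/eqP/negPn/negP => ne; apply: h; exists n.
case: (ex_minnP ex) => n ne nmin.
have eq m : (m < n)%N -> x m = y m.
  by move=> mn; apply/eqP; apply: contraLR mn => /nmin; rewrite leqNgt.
case xn : (x n) ne => ne; [right|left]; exists n; split => //.
- by move=> m /eq.
- by case: (y n) ne.
- by case: (y n) ne.
Qed.

Lemma lex_irr x : ~ lex x x. Proof. by move=> [n [_ ->]]. Qed.

Lemma lex_trans x y z : lex x y -> lex y z -> lex x z.
Proof.
move=> [m [xy xm ym]] [n [yz yn zn]]; have [mn|nm|e] := ltngtP m n.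
- exists m; rewrite -yz //; split => // i im.
  by rewrite xy // yz //; exact: ltn_trans mn.
- exists n; rewrite xy //; split => // i iN.
  by rewrite -yz // xy //; exact: ltn_trans nm.
- by move: yn; rewrite -e ym.
Qed.

Definition lex_seq : Type := big_lexi_order (fun _ : nat => bool).
HB.instance Definition _ := Order.Total.on lex_seq.

Definition lex_pair : Type := (lex_seq *l bool)%type.
HB.instance Definition _ := Order.Total.on lex_pair.

Lemma lex_seqP (x y : lex_seq) : (x < y)%O <-> lex x y.
Proof.
have le n a b : same_prefix n (a : lex_seq) b -> a n = false -> b n = true -> (a < b :> lex_seq)%O.
  move=> ab an bn; rewrite lt_neqAle; apply/andP; split.
    by apply/eqP => e; move: bn; rewrite -e an.
  have fd : first_diff (a : lex_seq) b = Some n.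
    by apply/first_diff_SomeP; split => //; rewrite an bn.
  by rewrite leEbig_lexi_order fd an bn.
have lexlt (a b : lex_seq) : lex a b -> (a < b)%O.
  by move=> [n [ab an bn]]; exact: le ab an bn.
split=> [xy|]; last exact: lexlt.
have [|//|/lexlt yx] := @lex_first x y; first by move=> e; move: xy; rewrite e ltxx.
by move: (lt_trans xy yx); rewrite ltxx.
Qed.

(** * The lexicographic Cantor set with the points of a given set split *)

Section split_space.
Variable A : set (nat -> bool).

(* [(x, false) < (x, true)] are the two halves of a split point [x]; a point
   outside [A] occurs only as [(x, false)]. *)
Definition split_pred : pred lex_pair := fun z => `[< z.2 -> A z.1 >].

Definition split_base := {z : lex_pair | split_pred z}.
HB.instance Definition _ := SubType.on split_base.
HB.instance Definition _ := [Order of split_base by <:].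

Definition split_space := order_topology split_base.
HB.instance Definition _ := OrderTopological.on split_space.

Local Notation X := split_space.

Definition sequence (z : X) : nat -> bool := (val z).1.
Definition side (z : X) : bool := (val z).2.

Lemma side_split z : side z -> A (sequence z).
Proof. by move=> sz; have /asboolP := valP (z : split_base); exact. Qed.

Lemma point_subproof x (b : bool) : (b -> A x) -> split_pred ((x, b) : lex_pair).
Proof. by move=> h; apply/asboolP. Qed.

Definition point x (b : bool) (h : b -> A x) : X :=
  exist _ ((x, b) : lex_pair) (point_subproof h).

Lemma split_ext (z w : X) : sequence z = sequence w -> side z = side w -> z = w.
Proof.
move=> e1 e2; apply: (val_inj : injective (val : split_base -> _)).
by apply: injective_projections.
Qed.

Lemma split_ltP (z w : X) : (z < w)%O <->
  lex (sequence z) (sequence w) \/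
  [/\ sequence z = sequence w, side z = false & side w = true].
Proof.
rewrite -[(z < w)%O]/((val (z : split_base) : lex_pair) < val (w : split_base))%O.
rewrite ltEprodlexi -/(sequence z) -/(side z) -/(sequence w) -/(side w).
split=> [/andP[]|].
- rewrite le_eqVlt => /predU1P[e|/lex_seqP zw _]; last by left.
  by rewrite e lexx /=; case: (side z); case: (side w) => //; right.
- case=> [/lex_seqP zw|[-> -> ->]]; last by rewrite lexx.
  by rewrite (ltW zw) /= leNgt zw.
Qed.

Lemma split_leP (z w : X) : (z <= w)%O <-> ~
  (lex (sequence w) (sequence z) \/
  [/\ sequence w = sequence z, side w = false & side z = true]).
Proof.
rewrite -(split_ltP w z) leNgt; split; first exact/negP.
by move=> h; apply/negP.
Qed.

(** The supremum of [S] is found bit by bit: [s n] is set when a member of [S] agrees with [s]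
    before [n] and has bit [n] set. The right half of [s] is taken exactly when it belongs to
    [S]. *)
Lemma split_compact : compact [set: X].
Proof.
apply: order_complete_compact => S.
pose Phi n (s : nat -> bool) := `[< exists z, [/\ S z,
  forall m, (m < n)%N -> sequence z m = s m & sequence z n] >].
pose p := fix p n := if n is k.+1 then rcons (p k) (Phi k (nth false (p k))) else [::].
have sp n : size (p n) = n by elim: n => //= n IH; rewrite size_rcons IH.
pose s n := nth false (p n.+1) n.
have pS k m : (m < k)%N -> nth false (p k) m = s m.
  elim: k => // k IH; rewrite ltnS leq_eqVlt => /predU1P[->//|mk].
  by rewrite /= nth_rcons sp mk IH.
have sE n : s n = Phi n s.
  rewrite /s /= nth_rcons sp ltnn eqxx; apply/asboolP/asboolP => -[z [Sz h zn]];
    by exists z; split => // m mn; rewrite h // pS.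
pose b := `[< exists z, [/\ S z, sequence z = s & side z] >].
have bA : b -> A s by move=> /asboolP[z [_ <- /side_split]].
exists (point bA); split=> [z Sz|u uS].
- apply/split_leP => -[[n [eq sn zn]]|[e bf zt]].
    have : s n = true by rewrite sE; apply/asboolP; exists z; split => // m /eq.
    by move: sn; rewrite /sequence /= => ->.
  have : b by apply/asboolP; exists z.
  by move: bf; rewrite /side /= => ->.
- apply/split_leP => -[[n [eq un sn]]|[e uf]].
    move: sn; rewrite /sequence /= sE => /asboolP[z [Sz zs zn]].
    have /split_leP := uS z Sz; apply; left; exists n; split => // m mn.
    by rewrite eq // zs.
  rewrite /side /= => /asboolP[z [Sz zs zt]].
  by have /split_leP := uS z Sz; apply; right; split => //; rewrite zs e.
Qed.

Hypothesis A_prepend : forall s x, A (prepend s x) <-> A x.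
Hypothesis A_alternating : forall x b n, A x -> exists2 m, (n <= m)%N & x m = b.

Lemma embed_subproof s (z : X) : side z -> A (prepend s (sequence z)).
Proof. by move=> /side_split Az; apply/A_prepend. Qed.

Definition embed s (z : X) : X := point (@embed_subproof s z).

Lemma embed_lt s (z w : X) : (z < w)%O -> (embed s z < embed s w)%O.
Proof.
move=> /split_ltP[zw|[e sz sw]]; apply/split_ltP; rewrite /sequence /side /=.
  by left; exact: lex_prepend.
by right; split => //; rewrite -/(sequence z) e.
Qed.

Definition cone s : set X :=
  [set z | forall m, (m < size s)%N -> sequence z m = nth false s m].

Lemma range_embed s : range (embed s) = cone s.
Proof.
apply/seteqP; split=> [_ [z _ <-] m ms|z zs]; first exact: prepend_nth.
pose y m := sequence z (size s + m).
have yE : prepend s y = sequence z.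
  by rewrite -{1}(_ : mkseq (sequence z) (size s) = s) ?prepend_mkseq //;
    apply: (@eq_from_nth _ false); rewrite ?size_mkseq // => i im; rewrite nth_mkseq // zs.
have Ay : side z -> A y by move=> /side_split; rewrite -yE => /A_prepend.
by exists (point Ay) => //; apply: split_ext.
Qed.

Lemma cone_convex s : order_convex (cone s).
Proof.
move=> x y z xs zs xy yz m ms; apply: contrapT => ym.
have [|lt|lt] := @lex_first (sequence y) (sequence x).
- by move=> e; apply: ym; rewrite e xs.
- by move/split_leP: xy => []; left.
- have [n [xyn xn yn]] := lt.
  have nm : (n <= m)%N by rewrite leqNgt; apply/negP => /xyn e; apply: ym; rewrite -e xs.
  have ns := leq_ltn_trans nm ms.
  move/split_leP: yz => []; left; exists n; split => // [i iN|].
    by rewrite -xyn // zs ?xs //; exact: ltn_trans iN ns.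
  by rewrite zs // -xs.
Qed.

Lemma cone_nil : cone [::] = setT. Proof. by apply/seteqP; split. Qed.

Lemma cone_ray b : cone [:: b] = [set z | sequence z 0 = b].
Proof. by apply/seteqP; split=> [z zb|z zb [|m] //]; exact: (zb 0). Qed.

Let zero_one : ~ A (prepend [:: false] xpredT).
Proof. by move=> /(A_alternating false 1)[[|m]]. Qed.

(** The sequences starting with 0 form the open ray below 1000..., and also the closed ray up to
    0111..., which is eventually constant and therefore not split. *)
Lemma cone_bit_clopen b : clopen (cone [:: b]).
Proof.
have c0 : clopen (cone [:: false]).
  have nA : false -> A (prepend [:: true] xpred0) by [].
  have nA' : false -> A (prepend [:: false] xpredT) by [].
  split.
    rewrite (_ : cone _ = `]-oo, point nA[%classic); first exact: lray_open.
    rewrite cone_ray.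
    apply/seteqP; split=> z /=; rewrite in_itv /=.
      by move=> z0; apply/split_ltP; left; exists 0.
    by move=> /split_ltP[[[|n] [h zn //]]|[_ _ //]].
  rewrite (_ : cone _ = `]-oo, point nA']%classic); first exact: lray_closed.
  rewrite cone_ray.
  apply/seteqP; split=> z /=; rewrite in_itv /=.
    move=> z0; apply/split_leP => -[[[|n] [_ e1 e2]]|[e _ sz]].
    - by rewrite z0 in e2.
    - by move: e1; rewrite /sequence /= /prepend /=.
    by apply: zero_one; rewrite [X in A X]e; exact: side_split.
  move=> /split_leP nlt; case z0: (sequence z 0) => //; case: nlt; left.
  by exists 0.
case: b => //; rewrite (_ : cone _ = ~` cone [:: false]).
  by case: c0 => o0 cl0; split; [rewrite openC|rewrite closedC].
by rewrite !cone_ray; apply/seteqP; split=> z /=; case: (sequence z 0).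
Qed.

Lemma range_embed_convex s : order_convex (range (embed s)).
Proof. by rewrite range_embed; exact: cone_convex. Qed.

Lemma embed_cons b s (z : X) : embed [:: b] (embed s z) = embed (b :: s) z.
Proof.
by apply: split_ext => //; apply/funext => -[|n] //=; rewrite /sequence /= /prepend /= subn1.
Qed.

(** By induction: a cone is the image of a shorter one under an embedding with open range. *)
Lemma cone_clopen s : clopen (cone s).
Proof.
elim: s => [|b s IH]; first by rewrite cone_nil; split; [exact: openT|exact: closedT].
have -> : cone (b :: s) = embed [:: b] @` cone s.
  rewrite -!range_embed image_comp; apply: eq_imagel => z _ /=.
  by rewrite embed_cons.
apply: clopen_image IH.
- exact: split_compact.
- exact: order_hausdorff.
- exact: (eps_continuous embed_lt range_embed_convex).
- move=> z w e; have [zw|wz|//] := ltgtP z w.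
    by have := embed_lt [:: b] zw; rewrite e ltxx.
  by have := embed_lt [:: b] wz; rewrite e ltxx.
- by rewrite range_embed; case: (cone_bit_clopen b).
Qed.

(** For a split [x], the ray that ends between its two halves. *)
Definition cut x : set X :=
  [set w | lex (sequence w) x \/ (sequence w = x /\ side w = false)].

(** The clause [false = false] gives the shape of [split_leP] at [point x false]. *)
Lemma cut_notP x (z : X) : ~ cut x z <-> lex x (sequence z) \/
  [/\ x = sequence z, false = false & side z = true].
Proof.
split=> [ncut|[xz|[xz _ sz]] [zx|[zx sz']]].
- have [xz|/lex_first[zx|xz]] := pselect (sequence z = x).
  + right; split => //; case sz: (side z) => //.
    by case: ncut; right.
  + by case: ncut; left.
  + by left.
- by apply: (@lex_irr x); exact: lex_trans zx.
- by move: xz; rewrite zx; exact: lex_irr.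
- by move: zx; rewrite xz; exact: lex_irr.
- by rewrite sz in sz'.
Qed.

Lemma cutP x (Ax : false -> A x) (z : X) : cut x z <-> (z <= point Ax)%O.
Proof.
split=> [zx|/split_leP h]; first by apply/split_leP => /(@cut_notP x z); apply.
by apply: contrapT => /cut_notP hz; exact: h.
Qed.

Lemma cut_ltP x (Ax : true -> A x) (z : X) : cut x z <-> (z < point Ax)%O.
Proof.
split=> [h|/split_ltP[|[]]]; [|by left|by right].
by apply/split_ltP; case: h => [|[]]; [left|right].
Qed.

Lemma cut_clopen x : A x -> clopen (cut x).
Proof.
move=> Ax; split.
  rewrite (_ : cut x = `]-oo, @point x true (fun=> Ax)[%classic).
    exact: lray_open.
  by apply/seteqP; split=> z /=; rewrite in_itv /= => /cut_ltP.
rewrite (_ : cut x = `]-oo, @point x false (fun=> Ax)]%classic).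
  exact: lray_closed.
by apply/seteqP; split=> z /=; rewrite in_itv /= => /cutP.
Qed.

Lemma cut_convex x : A x -> order_convex (cut x).
Proof.
move=> Ax u v w _ /(cutP (fun=> Ax)) wx _ vw; apply/(cutP (fun=> Ax)).
exact: le_trans wx.
Qed.

Lemma cutC_convex x : A x -> order_convex (~` cut x).
Proof.
move=> Ax u v w ux _ uv _ /(cutP (fun=> Ax)) vx; apply: ux; apply/(cutP (fun=> Ax)).
exact: le_trans vx.
Qed.

Lemma order_convexI (U V : set X) :
  order_convex U -> order_convex V -> order_convex (U `&` V).
Proof.
by move=> cU cV x y z [Ux Vx] [Uz Vz] xy yz; split; [apply: cU xy yz|apply: cV xy yz].
Qed.

(* The half of a cone on the side of [z] if [z] is split, else the whole cone. *)
Definition nbd (z : X) n : set X := cone (mkseq (sequence z) n) `&`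
  [set w | A (sequence z) -> (cut (sequence z) w <-> side z = false)].

Variant nbd_spec z n : set X -> Prop :=
| NbdRegular of ~ A (sequence z) : nbd_spec z n (cone (mkseq (sequence z) n))
| NbdLeft of A (sequence z) & side z = false :
    nbd_spec z n (cone (mkseq (sequence z) n) `&` cut (sequence z))
| NbdRight of A (sequence z) & side z = true :
    nbd_spec z n (cone (mkseq (sequence z) n) `&` ~` cut (sequence z)).

Lemma nbdP z n : nbd_spec z n (nbd z n).
Proof.
rewrite /nbd; have [Az|nAz] := pselect (A (sequence z)); last first.
  rewrite (_ : [set _ | _] = setT) ?setIT; first exact: NbdRegular.
  by apply/seteqP; split => // w _ /nAz.
case sz: (side z).
  rewrite (_ : [set _ | _] = ~` cut (sequence z)); first exact: NbdRight.
  by apply/seteqP; split=> w /= => [/(_ Az)[h _] /h|ncut _]; [|split].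
rewrite (_ : [set _ | _] = cut (sequence z)); first exact: NbdLeft.
by apply/seteqP; split=> w /= => [/(_ Az)[_]|cw _]; [apply|split].
Qed.

Lemma nbd_clopen z n : clopen (nbd z n).
Proof.
case: nbdP => [_|Az _|Az _]; first exact: cone_clopen.
- by apply: clopenI; [exact: cone_clopen|exact: cut_clopen].
- by apply: clopenI; [exact: cone_clopen|apply/clopenC/cut_clopen].
Qed.

Lemma nbd_convex z n : order_convex (nbd z n).
Proof.
case: nbdP => [_|Az _|Az _]; first exact: cone_convex.
- by apply: order_convexI; [exact: cone_convex|exact: cut_convex].
- by apply: order_convexI; [exact: cone_convex|exact: cutC_convex].
Qed.

Lemma nbd_self z n : nbd z n z.
Proof.
split=> [m|Az]; first by rewrite size_mkseq => mn; rewrite nth_mkseq.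
split=> [[/lex_irr//|[]//]|sz]; by right.
Qed.

Lemma cone_agree z n w : cone (mkseq (sequence z) n) w <->
  forall m, (m < n)%N -> sequence w m = sequence z m.
Proof.
split=> h m; have := h m; rewrite size_mkseq => {}h mn.
  by rewrite h // nth_mkseq.
by rewrite h // nth_mkseq.
Qed.

Lemma nbd_antimono z m n : (m <= n)%N -> nbd z n `<=` nbd z m.
Proof.
move=> mn w [/cone_agree wz cw]; split => //; apply/cone_agree => i im.
by apply: wz; exact: leq_trans mn.
Qed.

(** A strict inequality with [z] is either witnessed by a differing bit, and then holds on a long
    enough cone, or compares the two halves of a split point, and then the cut secures it. *)
Lemma nbd_basis (z : X) O : open O -> O z -> exists n, nbd z n `<=` O.
Proof.
move=> oO Oz; have : nbhs z O by exact: open_nbhs_nbhs.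
rewrite itv_nbhsE => -[i [io zi] iO].
have below l : (l < z)%O -> exists n, forall w, nbd z n w -> (l < w)%O.
  move=> /split_ltP[[k [lz lk zk]]|[e sl sz]].
    exists k.+1 => w [/cone_agree wz _]; apply/split_ltP; left; exists k.
    by rewrite wz //; split => // m mk; rewrite wz ?lz //; exact: leqW.
  have Az := side_split sz; exists 0 => w [_ /(_ Az)[h _]].
  have lE : l = @point (sequence z) false (fun=> Az) by exact: split_ext.
  rewrite lE ltNge; apply/negP => /cutP/h; by rewrite sz.
have above r : (z < r)%O -> exists n, forall w, nbd z n w -> (w < r)%O.
  move=> /split_ltP[[k [zr zk rk]]|[e sz sr]].
    exists k.+1 => w [/cone_agree wz _]; apply/split_ltP; left; exists k.
    by rewrite wz //; split => // m mk; rewrite wz ?zr //; exact: leqW.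
  have Az : A (sequence z) by rewrite e; exact: side_split.
  exists 0 => w [_ /(_ Az)[_ /(_ sz) cw]].
  have -> : r = @point (sequence z) true (fun=> Az) by apply: split_ext.
  exact/cut_ltP.
case: i io zi iO => [[[] l|[]] [[] r|[]]] //= _; rewrite in_itv /= ?andbT => zi iO.
- case/andP: zi => /below[m mP] /above[n nP]; exists (maxn m n) => w wn; apply: iO.
  rewrite /= in_itv /= mP ?nP //; apply: nbd_antimono wn; [exact: leq_maxr|exact: leq_maxl].
- by have [n nP] := below _ zi; exists n => w /nP lw; apply: iO; rewrite /= in_itv /= lw.
- by have [n nP] := above _ zi; exists n => w /nP lw; apply: iO; rewrite /= in_itv.
- by exists 0 => w _; apply: iO; rewrite /= in_itv.
Qed.

(** Flipping a bit of a split sequence past [n] gives a cone on one side of the cut; [A_alternating]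
    provides a bit whose flip leads to the required side. *)
Lemma cone_in_nbd z n : exists s, cone s `<=` nbd z n.
Proof.
have sub b m w : (n <= m)%N -> cone (rcons (mkseq (sequence z) m) b) w ->
    [/\ cone (mkseq (sequence z) n) w, sequence w m = b &
      forall i, (i < m)%N -> sequence w i = sequence z i].
  move=> nm cw; have eq i : (i < m)%N -> sequence w i = sequence z i.
    move=> im; rewrite (cw i) ?size_rcons ?size_mkseq ?leqW //.
    by rewrite nth_rcons size_mkseq im nth_mkseq.
  split => //; first by apply/cone_agree => i iN; apply: eq; exact: leq_trans nm.
  by rewrite (cw m) ?size_rcons ?size_mkseq // nth_rcons size_mkseq ltnn eqxx.
case: nbdP => [_|Az _|Az _]; first by exists (mkseq (sequence z) n).
- have [m nm zm] := A_alternating true n Az.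
  exists (rcons (mkseq (sequence z) m) false) => w /(sub _ _ _ nm)[cw wm wz].
  by split => //; left; exists m; split.
- have [m nm zm] := A_alternating false n Az.
  exists (rcons (mkseq (sequence z) m) true) => w /(sub _ _ _ nm)[cw wm wz].
  split => //; apply/cut_notP; left; exists m; split => // i /wz //.
Qed.

Lemma embed_dense (O : set X) : open O -> O !=set0 ->
  exists s, range (embed s) `<=` O.
Proof.
move=> oO [z Oz]; have [n nO] := nbd_basis oO Oz.
have [s sn] := cone_in_nbd z n; exists s; rewrite range_embed.
exact: subset_trans nO.
Qed.

Hypothesis A_lambda : forall D : set (nat -> bool), countable D ->
  exists (D' : set (nat -> bool)) (K : nat -> set (nat -> bool)),
  [/\ countable D', D `<=` D', forall n, prefix_closed (K n),
    forall n x, K n x -> ~ D' x & forall x, A x -> D' x \/ exists n, K n x].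

Lemma decidedI (V Q Q' : set X) : decided V Q -> decided V Q' -> decided V (Q `&` Q').
Proof.
case=> [VQ|VQ]; last by move=> _; right=> x /VQ nQ [].
case=> [VQ'|VQ']; last by right=> x /VQ' nQ [].
by left=> x Vx; split; [exact: VQ|exact: VQ'].
Qed.

Lemma clopen_decides (Q : set X) (z : X) : clopen Q ->
  exists N, [/\ open N, N z & forall U, U `<=` N -> decided U Q].
Proof.
move=> [oQ cQ]; have [Qz|nQz] := pselect (Q z).
  by exists Q; split => // U UQ; left.
by exists (~` Q); split => //; [rewrite openC|move=> U UQ; right].
Qed.

(** [z] is adjacent to the cut at its own sequence, so a convex set with points on both sides of the
    cut contains [z]. *)
Lemma convex_decides_cut (V : set X) (z : X) : order_convex V -> ~ V z ->
  A (sequence z) -> decided V (cut (sequence z)).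
Proof.
move=> cV nVz Az; apply: contrapT => /not_orP[/existsNP[v /not_implyP[Vv nv]] /existsNP[w /not_implyP[Vw /contrapT cw]]].
apply: nVz; case sz : (side z).
  have zE : z = @point (sequence z) true (fun=> Az) by exact: split_ext.
  apply: (cV w z v) => //; first by rewrite zE; apply/ltW/cut_ltP.
  by rewrite zE leNgt; apply/negP => /cut_ltP.
have zE : z = @point (sequence z) false (fun=> Az) by exact: split_ext.
apply: (cV w z v) => //; first by rewrite zE; apply/cutP.
by rewrite zE leNgt; apply/negP => /ltW /cutP.
Qed.

(* Only the points of [A] outside the countable set [D] have no neighbourhood
   base among the sets decided for large [n]; such a point is in some [K i],
   hence missed by admissible sets, and a convex set missing it lies on one
   side of it. *)
Lemma admissible_sets (M : set X) : countable M -> exists Adm : nat -> set (set X),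
  (forall n z, M z -> exists N, [/\ open N, N z &
     forall U, U `<=` N -> order_convex U -> Adm n U]) /\
  (forall z O, open O -> O z -> exists Q n, [/\ clopen Q, Q z, Q `<=` O &
     forall m V, (n <= m)%N -> Adm m V -> decided V Q]).
Proof.
move=> /(countable_image sequence)/A_lambda[D [K [cD MD Kc KD AK]]].
have /countable_injP[k kI] := cD.
exists (fun n V => [/\ order_convex V,
  forall s, (pickle s < n)%N -> decided V (cone s),
  forall x, D x -> A x -> (k x < n)%N -> decided V (cut x) &
  forall i, (i < n)%N -> forall z, V z -> ~ K i (sequence z)]); split.
- move=> n z Mz; elim: n => [|n [N [oN Nz NP]]].
    by exists setT; split => //; exact: openT.
  have [N1 [oN1 N1z N1P]] : exists N, [/\ open N, N z & forall U, U `<=` N ->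
      forall s, pickle s = n -> decided U (cone s)].
    have [[s sn]|ns] := pselect (exists s : seq bool, pickle s = n); last first.
      exists setT; split => //; first exact: openT.
      by move=> U _ s sn; case: ns; exists s.
    have [N1 [oN1 N1z N1P]] := clopen_decides z (cone_clopen s).
    exists N1; split => // U UN t tn.
    by rewrite (pcan_inj pickleK (etrans tn (esym sn))); exact: N1P.
  have [N2 [oN2 N2z N2P]] : exists N, [/\ open N, N z & forall U, U `<=` N ->
      forall x, D x -> A x -> k x = n -> decided U (cut x)].
    have [[x [Dx Ax kx]]|nx] := pselect (exists x, [/\ D x, A x & k x = n]); last first.
      exists setT; split => //; first exact: openT.
      by move=> U _ x Dx Ax kx; case: nx; exists x.
    have [N2 [oN2 N2z N2P]] := clopen_decides z (cut_clopen Ax).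
    exists N2; split => // U UN y Dy Ay ky.
    by rewrite (_ : y = x); [exact: N2P|apply: kI; rewrite ?inE // ky kx].
  (* [K n] is closed and misses the sequence of [z], which belongs to [D]. *)
  have [j jP] : exists j, forall w, cone (mkseq (sequence z) j) w -> ~ K n (sequence w).
    apply: contrapT => nj; apply: (KD n (sequence z)); last by apply: MD; exists z.
    apply: Kc => j; apply: contrapT => h; apply: nj; exists j => w /cone_agree wz Kw.
    by apply: h; exists (sequence w) => // m mj; rewrite wz.
  exists (N `&` (N1 `&` (N2 `&` cone (mkseq (sequence z) j)))); split.
  + apply: openI => //; apply: openI => //; apply: openI => //.
    by case: (cone_clopen (mkseq (sequence z) j)).
  + by do 3! split => //; apply/cone_agree.
  + move=> U UN cU; have [_ NPs NPx NPi] := NP U (fun w Uw => proj1 (UN w Uw)) cU.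
    split => //.
    * move=> s; rewrite ltnS leq_eqVlt => /predU1P[|/NPs//].
      by apply: N1P => w /UN[_ []].
    * move=> x Dx Ax; rewrite ltnS leq_eqVlt => /predU1P[|/NPx]; last exact.
      by apply: N2P => // w /UN[_ [_ []]].
    * move=> i; rewrite ltnS leq_eqVlt => /predU1P[-> w|/NPi//].
      by move=> /UN[_ [_ [_ /jP]]].
- move=> z O oO Oz; have [n nO] := nbd_basis oO Oz.
  pose s := mkseq (sequence z) n.
  have cutdec : A (sequence z) -> exists j, forall V, order_convex V ->
      (forall x, D x -> A x -> (k x < j)%N -> decided V (cut x)) ->
      (forall i, (i < j)%N -> forall z, V z -> ~ K i (sequence z)) ->
      decided V (cut (sequence z)).
    move=> Az; have [Dz|[i Kz]] := AK _ Az.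
      by exists (k (sequence z)).+1 => V _ + _; apply.
    exists i.+1 => V cV _ VK; apply: convex_decides_cut => // Vz.
    exact: VK Vz Kz.
  exists (nbd z n).
  have [j jP] : exists j, forall V, order_convex V ->
      (forall s, (pickle s < j)%N -> decided V (cone s)) ->
      (forall x, D x -> A x -> (k x < j)%N -> decided V (cut x)) ->
      (forall i, (i < j)%N -> forall z, V z -> ~ K i (sequence z)) ->
      decided V (nbd z n).
    case: nbdP => [_|/cutdec[j jP] _|/cutdec[j jP] _].
    + by exists (pickle s).+1 => V _ + _ _; apply.
    + exists (maxn (pickle s).+1 j) => V cV Vs Vx Vi; apply: decidedI.
        by apply: Vs; rewrite leq_max leqnn.
      apply: jP => // [x Dx Ax kx|i ij]; [apply: Vx => //|apply: Vi];
        by rewrite leq_max ?kx ?ij orbT.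
    + exists (maxn (pickle s).+1 j) => V cV Vs Vx Vi; apply: decidedI.
        by apply: Vs; rewrite leq_max leqnn.
      apply/decidedC/jP => // [x Dx Ax kx|i ij]; [apply: Vx => //|apply: Vi];
        by rewrite leq_max ?kx ?ij orbT.
  exists j; split => //; [exact: nbd_clopen|exact: nbd_self|].
  move=> m V jm [cV Vs Vx Vi]; apply: jP => //.
  + by move=> t tj; apply: Vs; exact: leq_trans jm.
  + by move=> x Dx Ax kx; apply: Vx => //; exact: leq_trans jm.
  + by move=> i ij; apply: Vi; exact: leq_trans jm.
Qed.

Lemma split_space_cdh : countable_dense_homogeneous X.
Proof.
apply: (self_similar_cdh split_compact embed_lt range_embed_convex).
- by move=> s; rewrite range_embed; case: (cone_clopen s).
- exact: embed_dense.
- have h x : false -> A x by [].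
  exists (point (h xpred0)), (point (h xpredT)); apply/split_ltP; left.
  by exists 0.
- move=> z; exists (nbd z); split=> [n|O]; last exact: nbd_basis.
  by split; [exact: nbd_clopen|exact: nbd_convex|exact: nbd_self].
- exact: admissible_sets.
Qed.

Definition nbds : set (set X) := [set U | exists z n, U = nbd z n].

Lemma nbds_basis : basis nbds.
Proof.
split=> [_ [z [n ->]]|z O]; first by case: (nbd_clopen z n).
rewrite nbhsE => -[O' [oO' O'z] O'O]; have [n nO] := nbd_basis oO' O'z.
exists (nbd z n); last exact: subset_trans O'O.
by split; [exists z, n|exact: nbd_self].
Qed.

Lemma split_space_clopen_base : has_clopen_base X.
Proof. by exists nbds; [exact: nbds_basis|move=> _ [z [n ->]]; exact: nbd_clopen]. Qed.

End split_space.

(** * Closure under exchange of prefixes, and the weight *)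

Section tail_closure.
Variables (W : eqType) (R : rel W) (c : W -> nat -> bool).
Hypothesis oR : omega1_well_order R.
Hypothesis c_inj : injective c.
Hypothesis c_alternating : forall x b n, exists2 m, (n <= m)%N & c x m = b.
Hypothesis c_lambda : forall D : set (nat -> bool), countable D ->
  exists K : nat -> set (nat -> bool), [/\ forall n, prefix_closed (K n),
    forall n x, K n x -> ~ D x & forall x, D (c x) \/ exists n, K n (c x)].

(** Tails are compared up to a shift, as prefixes of different lengths may be exchanged: this is the
    least set containing all [c w] and invariant under [prepend] in both directions. *)
Definition tail_closure : set (nat -> bool) :=
  [set x | exists w i j, forall n, x (i + n)%N = c w (j + n)%N].

Local Notation A := tail_closure.

Lemma tail_prepend s x : A (prepend s x) <-> A x.
Proof.
split=> -[w [i [j xc]]].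
  exists w, i, (j + size s)%N => n; rewrite -addnA -xc addnCA.
  by rewrite prepend_add.
by exists w, (size s + i)%N, j => n; rewrite -addnA prepend_add.
Qed.

Lemma tail_alternating x b n : A x -> exists2 m, (n <= m)%N & x m = b.
Proof.
move=> [w [i [j xc]]]; have [m jm cm] := c_alternating w b (j + n).
have jm' : (j <= m)%N by apply: leq_trans jm; exact: leq_addr.
exists (i + (m - j))%N; last by rewrite xc subnKC.
by apply: leq_trans (leq_addl _ _); rewrite leq_subRL.
Qed.

Lemma prepend_tail x i y j : (forall n, x (i + n)%N = y (j + n)%N) ->
  prepend (mkseq y j) (fun n => x (i + n)%N) = y.
Proof. by move=> /funext ->; exact: prepend_mkseq. Qed.

(** [D'] is the tail closure of [D], and the new closed sets are the preimages of the [K n] under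
    the countably many prefix exchanges. They miss [D'] since it is invariant, and every member of
    the tail closure of [c] becomes some [c w] by an exchange. *)
Lemma tail_lambda (D : set (nat -> bool)) : countable D ->
  exists (D' : set (nat -> bool)) (K : nat -> set (nat -> bool)),
  [/\ countable D', D `<=` D', forall n, prefix_closed (K n),
    forall n x, K n x -> ~ D' x & forall x, A x -> D' x \/ exists n, K n x].
Proof.
move=> cD; pose D' := [set y | exists d i j, D d /\ forall n, d (i + n)%N = y (j + n)%N].
have cD' : countable D'.
  have : countable (\bigcup_(p in [set: seq bool * nat])
      ((fun d n => prepend p.1 (fun m => d (p.2 + m)%N) n) @` D)).
    by apply: bigcup_countable => [|p _]; [exact: countableP|exact: countable_image].
  apply: sub_countable; apply: subset_card_le => y [d [i [j [Dd dy]]]].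
  exists (mkseq y j, i) => //; exists d => //=; exact: prepend_tail.
have [K [Kc KD DK]] := c_lambda cD'.
pose K' (p : seq bool * nat * nat) x := K p.2 (prepend p.1.1 (fun m => x (p.1.2 + m)%N)).
exists D', (fun n => if unpickle n is Some p then K' p else set0); split => //.
- by move=> d Dd; exists d, 0, 0.
- move=> n; case: unpickle => [[[t i] k]|] x /= xK; last by have [] := xK 0.
  apply: Kc => m; have [y Ky xy] := xK (i + m)%N.
  exists (prepend t (fun m => y (i + m)%N)) => // l lm.
  rewrite /prepend; case: ltnP => // tl; apply: xy; rewrite ltn_add2l.
  exact: leq_ltn_trans (leq_subr _ _) lm.
- move=> n x; case: unpickle => [[[t i] k]|//] /KD nD [d [i' [j' [Dd dx]]]].
  apply: nD; exists d, (i' + i)%N, (size t + j')%N; split => // m.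
  by rewrite -addnA dx -addnA prepend_add /= addnCA.
- move=> x [w [i [j xc]]]; have [[d [i' [j' [Dd dc]]]]|[n Kn]] := DK w; [left|right].
    exists d, (i' + j)%N, (i + j')%N; split => // n.
    by rewrite -!addnA xc dc addnCA.
  exists (pickle (mkseq (c w) j, i, n)); rewrite pickleK /K' /=.
  by rewrite prepend_tail.
Qed.

Local Notation X := (split_space A).

(** A cone is finite data; a half cone is given by an index and finite data, because its split point
    is a tail of some [c w] behind a prefix. *)
Lemma nbds_card_le : (@nbds A #<= [set: W * nat])%card.
Proof.
pose g (p : W * nat) : set X :=
  match unpickle p.2 : option (seq bool + seq bool * nat * nat * bool) with
  | Some (inl s) => @cone A s
  | Some (inr (t, j, n, b)) =>
      let x := prepend t (fun m => c p.1 (j + m)%N) in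
      @cone A (mkseq x n) `&` (if b then ~` @cut A x else @cut A x)
  | None => set0
  end.
apply: card_le_trans (card_image_le g _); apply: subset_card_le => _ [z [n ->]].
have repr : A (sequence z) -> exists w t j,
    sequence z = prepend t (fun m => c w (j + m)%N).
  move=> [w [i [j zc]]]; exists w, (mkseq (sequence z) i), j.
  by rewrite prepend_tail.
case: nbdP => [_|/repr[w [t [j zE]]] _|/repr[w [t [j zE]]] _].
- have [w _] : exists w : W, True.
    apply: contrapT => nW; have [_ cW _] := oR; apply: cW.
    by rewrite (_ : setT = set0) //; apply/seteqP; split => // w; case: nW; exists w.
  exists (w, pickle (inl (mkseq (sequence z) n) : seq bool + seq bool * nat * nat * bool)) => //.
  by rewrite /g pickleK.
- exists (w, pickle (inr (t, j, n, false) : seq bool + seq bool * nat * nat * bool)) => //.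
  by rewrite /g pickleK /= zE.
- exists (w, pickle (inr (t, j, n, true) : seq bool + seq bool * nat * nat * bool)) => //.
  by rewrite /g pickleK /= zE.
Qed.

(** Within the cut at [a p], a base has a member with greatest element [z p], and different greatest
    elements give different members. The prefix of [n] ones and a zero records [n], so [a] is
    injective on pairs. *)
Lemma basis_card_ge (B : set (set X)) : basis B -> ([set: W * nat] #<= B)%card.
Proof.
move=> [oB bB]; pose a (p : W * nat) := prepend (rcons (nseq p.2 true) false) (c p.1).
have aA p : A (a p) by apply/tail_prepend; exists p.1, 0, 0.
have a_inj : injective a.
  have head p m : (m <= p.2)%N -> a p m = (m < p.2)%N.
    move=> mp; rewrite /a prepend_nth ?size_rcons ?size_nseq // nth_rcons size_nseq.
    by rewrite nth_nseq; case: ltnP => // pm; case: eqP.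
  move=> [w m] [u n] e; have mn : m = n.
    have [lt|lt|//] := ltngtP m n.
      have := head (w, m) m (leqnn _); rewrite ltnn e head /=; last exact: ltnW.
      by rewrite lt.
    have := head (u, n) n (leqnn _); rewrite ltnn -e head /=; last exact: ltnW.
    by rewrite lt.
  rewrite -mn in e *; congr pair; apply: c_inj; apply/funext => i.
  by rewrite -(prepend_add (rcons (nseq m true) false) (c w) i) -[LHS]/(a (w, m) _) e /a prepend_add.
pose z p : X := @point A (a p) false (fun=> aA p).
have exU p : exists U, [/\ B U, U (z p) & U `<=` @cut A (a p)].
  have [|U [BU Uz] Uc] := bB (z p) (@cut A (a p)).
    apply: open_nbhs_nbhs; split; first by case: (cut_clopen (aA p)).
    by right.
  by exists U.
have [f fP] := choice exU.
have f_inj : injective f.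
  move=> p q e; apply: a_inj; have [_ fp fcp] := fP p; have [_ fq fcq] := fP q.
  have pq : (z p <= z q)%O by apply/cutP/fcq; rewrite -e.
  have qp : (z q <= z p)%O by apply/cutP/fcp; rewrite e.
  by have := le_anti (introT andP (conj pq qp)) => /(congr1 (@sequence A)).
have /card_eqPle[_ le] : (f @` setT #= [set: W * nat])%card.
  by apply: inj_card_eq => p q _ _; exact: f_inj.
apply: card_le_trans le _; apply: subset_card_le => _ [p _ <-].
by have [] := fP p.
Qed.

Lemma split_space_weight : has_weight_omega1 X.
Proof.
exists ((W * nat)%type : eqType), (fun x y => if x.1 == y.1 then (x.2 <= y.2)%N else R x.1 y.1).
split; first exact: omega1_prod_nat.
have bn := nbds_basis tail_prepend tail_alternating.
split; last exact: basis_card_ge.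
exists (@nbds A) => //; apply/card_eqPle; split; first exact: nbds_card_le.
exact: basis_card_ge.
Qed.

End tail_closure.

Theorem theorem5p7 :
  exists (d : Order.disp_t) (X : orderTopologicalType d),
    [/\ compact [set: X],
        has_clopen_base X,
        countable_dense_homogeneous X &
        has_weight_omega1 X].
Proof.
have [W [R oR]] := omega1_exists.
have [c [c_inj c_alt c_lambda]] := lambda_prime_set oR.
have pre := @tail_prepend W c; have alt := tail_alternating c_alt.
exists _, (split_space (tail_closure c) : orderTopologicalType _); split.
- exact: split_compact.
- exact: split_space_clopen_base pre alt.
- exact: split_space_cdh pre alt (tail_lambda c_lambda).
- exact: split_space_weight oR c_inj c_alt.
Qed.
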